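(* Let $n\ge1$, let $N\ge0$ be an integer, let $a,c,d,e,b_1,\dots,b_n,x_1,\dots,x_n$ be complex parameters, and write $B=b_1\cdots b_n$. Then \begin{align*} &\sum_{\substack{0\le|\boldsymbol k|\le N\\ k_1,\dots,k_n\ge0}}\Bigg(\prod_{1\le r<s\le n}\frac{\theta(q^{k_r-k_s}x_r/x_s;p)}{\theta(x_r/x_s;p)}\prod_{r,s=1}^n\frac{(b_sx_r/x_s;q,p)_{k_r}}{(qx_r/x_s;q,p)_{k_r}}\cdot\frac{\theta(aq^{2|\boldsymbol k|};p)}{\theta(a;p)}\\ &\quad\times\frac{(a,\,c,\,d,\,a^2q^{1+N}/(Bcd),\,q^{-N};q,p)_{|\boldsymbol k|}}{(aq/B,\,aq/c,\,aq/d,\,Bcdq^{-N}/a,\,aq^{N+1};q,p)_{|\boldsymbol k|}}\\ &\quad\times\prod_{r=1}^n\frac{(ex_r/B;q,p)_{k_r}(ex_r;q,p)_{|\boldsymbol k|}}{(ex_r;q,p)_{k_r}(ex_r/b_r;q,p)_{|\boldsymbol k|}}\cdot q^{\sum_{r=1}^n rk_r}\Bigg)\\ &=\frac{(aq,\,aq/(Bc),\,aq/(Bd),\,aq/(cd);q,p)_N}{(aq/B,\,aq/c,\,aq/d,\,aq/(Bcd);q,p)_N}. \end{align*}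
   Context: Let $q,p$ be complex numbers with $q\neq 0$ and $|p|<1$. For $a\ne 0$ put $\theta(a;p)=\prod_{j\ge 0}(1-ap^j)(1-p^{j+1}/a)$. For an integer $k\ge 0$ the $q,p$-shifted factorial is $(a;q,p)_k=\prod_{j=0}^{k-1}\theta(aq^j;p)$ (empty product $=1$). Write $(a_1,\dots,a_m;q,p)_k=(a_1;q,p)_k\cdots(a_m;q,p)_k$. For a tuple $\boldsymbol k=(k_1,\dots,k_n)$, $|\boldsymbol k|=k_1+\cdots+k_n$. All parameters are nonzero and generic in the sense that no denominators in the formula vanish. *)

(* Defs.v *)
From HB Require Import structures.
From mathcomp Require Import all_boot all_order all_algebra.
From mathcomp Require Import all_classical all_reals all_analysis.
From mathcomp Require Import complex.

Set Implicit Arguments.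
Unset Strict Implicit.
Unset Printing Implicit Defensive.

Import Order.TTheory GRing.Theory Num.Theory.
Import numFieldNormedType.Exports.

Local Open Scope classical_set_scope.
Local Open Scope ring_scope.

(** The definitions are over any [numFieldType], which carries the topology of
    its norm; for [C := R[i]] with [R : realType] it is the usual topology of
    the complex numbers, and the product converges when [`|p| < 1]. *)

(** theta(a; p) = prod_(j >= 0) (1 - a p^j) (1 - p^(j+1) / a) *)
Definition theta (C : numFieldType) (a p : C) : C :=
  limn (fun m : nat =>
    \prod_(0 <= j < m) ((1 - a * p ^+ j) * (1 - p ^+ j.+1 / a))).

(** (a; q, p)_k *)
Definition qpfact (C : numFieldType) (a q p : C) (k : nat) : C :=
  \prod_(0 <= j < k) theta (a * q ^+ j) p.

(** (a_1, ..., a_m; q, p)_k with [s = [:: a_1; ...; a_m]] *)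
Definition qpfacts (C : numFieldType) (s : seq C) (q p : C) (k : nat) : C :=
  \prod_(a <- s) qpfact a q p k.

(* Main.v *)
Require Import Defs.
From HB Require Import structures.
From mathcomp Require Import all_boot all_order all_algebra.
From mathcomp Require Import all_classical all_reals all_analysis.
From mathcomp Require Import complex.
From mathcomp Require Import ring lra zify.
Import Order.TTheory GRing.Theory Num.Theory.
Import numFieldNormedType.Exports.
Local Open Scope ring_scope.

(** Write K = |k|. Apart from a factor that depends on k only through K, the
    summand is the summand of a sum over all compositions of K into n parts,
    and that inner sum has a closed form: by [An_sum] it equals
    (B)_K prod_r (e x_r / b_r)_K / ((q)_K prod_r (e x_r)_K). Once it is inserted,
    e and the x_r disappear and what remains is the one-variable elliptic
    Jackson sum of Frenkel and Turaev, with B as one of its parameters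
    ([jackson_sum]). The two are put together in [multi_jackson].

    The closed form of the inner sum is found by induction on K. With
    Z_r = x_r q^(k_r), elliptic Lagrange interpolation ([theta_lagrange_inv])
    splits the summand at a composition k of K + 1 into n parts, the i-th of
    which is a multiple of the summand at k with k_i lowered by one. Collected
    by the lowered composition, the n parts are again an interpolation sum,
    whose value no longer depends on the composition. Both interpolations use
    the free parameter e q^K, and this common choice is what makes them fit
    together ([An_sum_rec]).

    The one-variable sum is the case n = 2 of the same induction: a composition
    of N into two parts is a single summation index, and a = q^(-N) z_1 / z_2.
    In this reading theta (a q^j) enters denominators of the intermediate sums
    although it may vanish, so that the induction is carried out on terms
    multiplied by a common denominator ([FT_sum]).

    All of this is algebra over a field and uses four properties of theta, which
    form the predicate [theta_like]: theta vanishes at 1, theta (1/a) equals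
    - theta a / a, quotients of zeros are zeros, and the addition formula of
    Weierstrass holds. The zeros of the infinite product are the zeros of its
    factors, that is, the integral powers of p, because a tail of the product is
    bounded away from 0 ([theta_eq0P]).

    The addition formula says that the antisymmetric kernel
    f x y = theta (x y) theta (x / y) / x has vanishing four by four Pfaffians,
    and this holds because f has rank two. Indeed, as a function of y, f is a
    Laurent series whose behaviour under y -> p y forces its coefficients to
    satisfy g_(d+2) = p^(d+1) g_d, so that the series is determined by two of
    them. To avoid infinite Laurent series, the argument is made for the
    truncated products: these are Laurent polynomials whose coefficients obey
    the recurrence up to an error of order p^m, with bounds that are uniform
    in m and come from a majorant polynomial with positive coefficients. Hence
    the kernel is a limit of matrices of rank two ([theta_kernel_approx]), its
    three by three minors vanish ([theta_kernel_minor]), and so do the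
    Pfaffians ([pfaffian_of_minors]). *)

Set Implicit Arguments.
Unset Strict Implicit.
Unset Printing Implicit Defensive.

(** * Elliptic Lagrange interpolation *)

(** The addition formula is Weierstrass's identity between products of four
    theta values, in five multiplicative variables (one of them redundant by
    homogeneity) so that no square roots occur in the arguments. *)
Record theta_like (F : fieldType) (th : F -> F) : Prop := ThetaLike {
  theta_like_one : th 1 = 0;
  theta_like_inv : forall a, a != 0 -> th a^-1 = - th a / a;
  theta_like_zero_div : forall a b, a != 0 -> b != 0 ->
    th a = 0 -> th b = 0 -> th (a / b) = 0;
  theta_like_addition : forall s w z1 z2 y,
    s != 0 -> w != 0 -> z1 != 0 -> z2 != 0 -> y != 0 ->
    th s * th (s * z2 * w / (y * z1)) * th (z1 / y) * th (w / z2) =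
    th (s * z2 / y) * th (s * w / z1) * th (z1 / z2) * th (w / y) +
    z1 / z2 * (th (s * z2 / z1) * th (z2 / y) * th (s * w / y) * th (w / z1))
}.

Section Interpolation.
Variables (F : fieldType) (th : F -> F) (thP : theta_like th).

Let thVE a : a != 0 -> th a^-1 = - th a / a := theta_like_inv thP (a := a).

(** Elliptic Lagrange interpolation: both sides, as functions of w, are theta
    functions of degree [size ys] with the same multiplier, and they agree at the
    points Z i. The algebraic proof removes one node z and one zero y at a time,
    with s replaced by s y / z, using the addition formula on each summand; the new
    summand at the removed node is the induction hypothesis at w = z. One
    divides by theta of the new s, which must not be 0: if it vanished for two
    choices z, z' of the node, then theta (z / z') would vanish too. *)
Lemma theta_lagrange (I : finType) (ys : seq F) (A : {set I}) (Z : I -> F)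
    (s w : F) :
  size ys = #|A| -> s != 0 -> w != 0 ->
  (forall i, Z i != 0) -> (forall y, y \in ys -> y != 0) ->
  {in A &, forall i j, i != j -> th (Z i / Z j) != 0} ->
  s * \prod_(y <- ys) y = \prod_(i in A) Z i ->
  th s * \prod_(y <- ys) th (w / y) =
  \sum_(i in A) (th (s * w / Z i) * \prod_(y <- ys) th (Z i / y)
    * \prod_(j in A | j != i) (th (w / Z j) / th (Z i / Z j))).
Proof.
elim: ys A s w => [|y ys IHys] A s w.
  move=> /esym/eqP; rewrite cards_eq0 => /eqP-> s0 w0 Z0 _ _.
  by rewrite !big_nil !big_set0 !mulr1 => ->; rewrite (theta_like_one thP).
move=> szA s0 w0 Z0 y0 ZA; rewrite !big_cons => sE.
have yn0 : y != 0 by rewrite y0 ?mem_head.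
have y0' z : z \in ys -> z != 0 by move=> zys; rewrite y0 // inE zys orbT.
have [i0 iA th0] : exists2 i, i \in A & #|A| == 1 \/ th (s * y / Z i) != 0.
  have [/eqP A1|A1] := boolP (#|A| == 1%N).
    have /eqP/cards1P[i Ai] : #|A| = 1%N := A1.
    by exists i; [rewrite Ai set11 | left].
  have : (1 < #|A|)%N by rewrite ltn_neqAle eq_sym A1 -szA.
  case/card_gt1P => i [j [iA jA ij]].
  have [thi|] := eqVneq (th (s * y / Z i)) 0; last by exists i => //; right.
  have [thj|] := eqVneq (th (s * y / Z j)) 0; last by exists j => //; right.
  have := theta_like_zero_div thP _ _ thj thi.
  rewrite !mulf_neq0 ?invr_neq0 // => /(_ isT isT).
  rewrite (_ : _ / _ = Z i / Z j); last by field; rewrite s0 yn0 !Z0.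
  by move/eqP; rewrite (negbTE (ZA i j _ _ _)).
have i0A' i : i \in A :\ i0 -> (i \in A) && (i != i0).
  by rewrite in_setD1 andbC.
case: th0 => [A1|th0].
  have ysE : ys = [::].
    by apply/nilP; move: szA; rewrite /nilp (eqP A1) => -[->].
  move: A1 => /cards1P[i Ai]; rewrite Ai ysE big_nil mulr1 big_set1 in sE.
  rewrite Ai ysE !big_set1 -sE !big_cons !big_nil !mulr1 big_pred0 ?mulr1.
    rewrite mulrC; congr (th _ * th _); field; rewrite ?s0 ?yn0 //.
  by move=> j; rewrite inE; case: eqP.
set s0' := s * y / Z i0 in th0.
have s0'n0 : s0' != 0 by rewrite !mulf_neq0 ?invr_neq0.
pose P v := \prod_(z <- ys) th (v / z).
have IH v : v != 0 -> th s0' * P v = \sum_(i in A :\ i0)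
    (th (s0' * v / Z i) * P (Z i) *
     \prod_(j in A :\ i0 | j != i) (th (v / Z j) / th (Z i / Z j))).
  move=> v0; apply: IHys => //.
  - by move: szA; rewrite (cardsD1 i0) iA => -[].
  - by move=> i j /i0A'/andP[iA' _] /i0A'/andP[jA' _]; apply: ZA.
  - apply: (mulfI (Z0 i0)); rewrite (big_setD1 i0 iA) /= in sE.
    by rewrite -sE /s0'; field; rewrite Z0.
apply: (mulfI th0); rewrite (big_setD1 i0 iA) /= mulrDr.
(* The first part sums to the induction hypothesis at w, the second one to the
   induction hypothesis at w = Z i0. *)
have ex i : i \in A :\ i0 ->
    th s0' * (th (s * w / Z i) * \prod_(z <- y :: ys) th (Z i / z) *
      \prod_(j in A | j != i) (th (w / Z j) / th (Z i / Z j))) =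
    th s * th (w / y) * (th (s0' * w / Z i) * P (Z i) *
      \prod_(j in A :\ i0 | j != i) (th (w / Z j) / th (Z i / Z j)))
    - th (s * w / Z i0) * th (Z i0 / y) *
      (th (s0' * Z i0 / Z i) * P (Z i) *
       \prod_(j in A :\ i0 | j != i) (th (Z i0 / Z j) / th (Z i / Z j))) *
      \prod_(j in A :\ i0) (th (w / Z j) / th (Z i0 / Z j)).
  move=> iA'; have /andP[iA1 ii0] := i0A' _ iA'.
  have t1 : th (Z i / Z i0) != 0 by apply: ZA.
  have t2 : th (Z i0 / Z i) = - (Z i0 / Z i) * th (Z i / Z i0).
    by rewrite -[in LHS]invf_div thVE ?mulf_neq0 ?invr_neq0 // invf_div mulNr mulNr mulrC.
  rewrite big_cons (bigD1 i0) /=; last by rewrite iA eq_sym.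
  rewrite (eq_bigl (fun j => (j \in A :\ i0) && (j != i))); last first.
    by move=> j; rewrite in_setD1 [RHS]andbC andbA [RHS]andbC andbA.
  have -> : \prod_(j in A :\ i0) (th (w / Z j) / th (Z i0 / Z j)) =
      th (w / Z i) / th (Z i0 / Z i) *
      \prod_(j in A :\ i0 | j != i) (th (w / Z j) / th (Z i0 / Z j)).
    by rewrite (bigD1 i).
  set Q1 := \prod_(j in _ | _) (th (w / _) / th (Z i / _)).
  set Q2 := \prod_(j in _ | _) (th (Z i0 / _) / th (Z i / _)).
  set Q3 := \prod_(j in _ | _) (th (w / _) / th (Z i0 / _)).
  have QE : Q1 = Q2 * Q3.
    rewrite -big_split; apply: eq_bigr => j /andP[/i0A'/andP[jA ji0] ji] /=.
    field; rewrite !ZA //; first by rewrite eq_sym.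
    by rewrite eq_sym.
  rewrite -/(P (Z i)) QE t2.
  have := theta_like_addition thP s0'n0 w0 (Z0 i) (Z0 i0) yn0.
  rewrite (_ : s0' * Z i0 / y = s); last by rewrite /s0'; field; rewrite yn0 Z0.
  rewrite (_ : s0' * Z i0 * w / (y * Z i) = s * w / Z i); last first.
    by rewrite /s0'; field; rewrite yn0 !Z0.
  rewrite (_ : s0' * w / y = s * w / Z i0); last first.
    by rewrite /s0'; field; rewrite yn0 !Z0.
  move=> E3.
  transitivity (th s0' * th (s * w / Z i) * th (Z i / y) * th (w / Z i0) *
     (P (Z i) * Q2 * Q3 / th (Z i / Z i0))); first by field.
  by rewrite E3; field; rewrite oppr_eq0 t1 !Z0.
rewrite [X in _ + X]mulr_sumr (eq_bigr _ ex) /= sumrB -mulr_sumr -IH // -mulr_suml -mulr_sumr -IH //.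
rewrite big_cons -/(P w) -/(P (Z i0)).
rewrite (eq_bigl (fun j => j \in A :\ i0)); first by ring.
by move=> j; rewrite in_setD1 andbC.
Qed.

(** The previous formula at w = 1 / l. The monomials that come from inverting the
    arguments are the same in all terms, because s is the ratio of the two
    products. *)
Lemma theta_lagrange_inv (I : finType) (Z y : I -> F) (s l : F) :
  s != 0 -> l != 0 -> (forall i, Z i != 0) -> (forall i, y i != 0) ->
  (forall i j, i != j -> th (Z i / Z j) != 0) ->
  s * \prod_j y j = \prod_i Z i ->
  th s * \prod_j th (l * y j) =
  \sum_i (th (l * Z i / s) * \prod_j th (Z i / y j)
    * \prod_(j | j != i) (th (l * Z j) / th (Z i / Z j))).
Proof.
move=> s0 l0 Z0 y0 ZI sE.
have lV : l^-1 != 0 by rewrite invr_neq0.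
have := @theta_lagrange I [seq y j | j <- enum I] [set: I] Z s l^-1.
rewrite size_map -cardE cardsT => /(_ erefl s0 lV Z0) H.
have {H} := H _ _ _; rewrite !big_image /=.
(* k is the common monomial. *)
pose k := \prod_(j : I) (- (l * y j)^-1).
have k0 : k != 0.
  by apply/prodf_neq0 => j _; rewrite oppr_eq0 invr_neq0 // mulf_neq0.
have kE : k = s * \prod_(j : I) (- (l * Z j)^-1).
  have nz : \prod_i y i != 0 by apply/prodf_neq0 => i _; apply: y0.
  have fE (f : I -> F) : \prod_i (- (l * f i)^-1) =
      (\prod_(i : I) - l^-1) / \prod_i f i.
    rewrite -prodfV -big_split; apply: eq_bigr => i _ /=.
    by rewrite invfM mulNr.
  by rewrite /k !fE -sE; field; rewrite s0 nz.
move=> H; apply: (mulfI k0); rewrite mulrCA -big_split /=.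
under eq_bigr => j _.
  rewrite [_ * _](_ : _ = th (l^-1 / y j)); last first.
    by rewrite -invfM thVE ?mulf_neq0 //; field; rewrite l0 y0.
  over.
rewrite H; last 3 first.
- by move=> y1 /mapP[j _ ->].
- by move=> i j _ _; apply: ZI.
- by rewrite sE; apply: eq_bigl => i; rewrite finset.in_setT.
rewrite mulr_sumr (eq_bigl predT); last by move=> i; rewrite finset.in_setT.
apply: eq_bigr => i _; rewrite (bigD1 i) //= in kE.
rewrite kE big_image /=.
have -> : th (s / l / Z i) = - th (l * Z i / s) / (l * Z i / s).
  by rewrite -thVE ?mulf_neq0 ?invr_neq0 //; congr th; field; rewrite l0 s0 Z0.
have -> : \prod_(j in [set: I] | j != i) (th (l^-1 / Z j) / th (Z i / Z j)) =
   \prod_(j | j != i) (- (l * Z j)^-1) *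
   \prod_(j | j != i) (th (l * Z j) / th (Z i / Z j)).
  rewrite -big_split; apply: eq_big => j; first by rewrite finset.in_setT.
  by move=> _ /=; rewrite -invfM thVE ?mulf_neq0 //; ring.
by field; rewrite s0 l0 Z0.
Qed.

End Interpolation.

(** * The sum over compositions of K *)

Definition tfact (F : fieldType) (th : F -> F) (a q : F) (k : nat) : F :=
  \prod_(0 <= j < k) th (a * q ^+ j).

Section Multisum.
Variables (F : fieldType) (th : F -> F) (thP : theta_like th).
Variables (q : F) (q0 : q != 0).
Local Notation "a `_[ k ]" := (tfact th a q k) (at level 3).

Lemma tfact0 a : a`_[0] = 1.
Proof. by rewrite /tfact big_nil. Qed.

Lemma tfactS a k : a`_[k.+1] = a`_[k] * th (a * q ^+ k).
Proof. by rewrite /tfact big_nat_recr. Qed.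

Lemma tfact_neq0 a k : a`_[k] != 0 ->
  forall j, (j < k)%N -> th (a * q ^+ j) != 0.
Proof.
move=> + j jk; rewrite /tfact big_mkord => /prodf_neq0 /(_ (Ordinal jk)).
exact.
Qed.

Variables (n : nat) (x b : 'I_n -> F) (e : F).
Hypotheses (x0 : forall r, x r != 0) (b0 : forall r, b r != 0) (e0 : e != 0).
Let B := \prod_r b r.

(** The exponent of q is sum_r r (k r) with r counted from 0; this is the
    normalisation for which the sum over all k with a given |k| has a closed
    form. *)
Definition An_term (k : 'I_n -> nat) : F :=
  (\prod_(r < n) \prod_(s < n | (r < s)%N)
      (th (q ^ ((k r)%:Z - (k s)%:Z) * x r / x s) / th (x r / x s)))
  * (\prod_(r < n) \prod_(s < n)
       ((b s * x r / x s)`_[k r] / (q * x r / x s)`_[k r]))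
  * (\prod_(r < n) ((e * x r / B)`_[k r] / (e * x r)`_[k r]))
  * q ^+ (\sum_(r < n) r * k r)%N.

(** Raising the index k_i changes only the pairs {r, s} that contain i. A pair
    with i as its second element carries an extra factor c, and there are i such
    pairs. *)
Lemma prod_pairs_at (i : 'I_n) (c : F) (rho : 'I_n -> F) :
  \prod_(r < n) \prod_(s < n | (r < s)%N)
     (if r == i then rho s else if s == i then c * rho r else 1) =
  c ^+ i * \prod_(s | s != i) rho s.
Proof.
rewrite (bigD1 i) //= eqxx.
rewrite [\prod_(s | s != i) rho s](bigID (fun s : 'I_n => (i < s)%N)) /=.
rewrite [RHS]mulrCA /=; congr (_ * _).
  apply: eq_bigl => s; apply/idP/andP => [|[]//].
  by move=> si; split=> //; apply: contraTneq si => ->; rewrite ltnn.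
rewrite (eq_bigr (fun r : 'I_n => if (r < i)%N then c * rho r else 1)); last first.
  move=> r ri; rewrite (negbTE ri); case: ifP => [lri|/negbT nlri].
    rewrite (bigD1 i) //= eqxx big1 ?mulr1 // => s /andP[_ /negbTE->] //.
  by apply: big1 => s rs; case: eqP => // si; rewrite -si rs in nlri.
rewrite -big_mkcondr /= (eq_bigl (fun r : 'I_n => (r < i)%N)); last first.
  move=> r; apply/andP/idP => [[]//|ri]; split=> //.
  by apply: contraTneq ri => ->; rewrite ltnn.
rewrite [in RHS](eq_bigl (fun r : 'I_n => (r < i)%N)); last first.
  by move=> r; rewrite -leqNgt ltn_neqAle -val_eqE.
rewrite big_split prodr_const; congr (_ ^+ _ * _).
rewrite -sum1_card (eq_bigl (fun r : 'I_n => (r < i)%N)) //.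
by rewrite (big_ord_narrow (ltnW (ltn_ord i))) sum1_card card_ord.
Qed.

Lemma prod_at (i : 'I_n) (G : 'I_n -> nat -> F) (k k' : 'I_n -> nat) g :
  (forall r, k r = (k' r + (r == i))%N) ->
  G i (k' i).+1 = G i (k' i) * g ->
  \prod_r G r (k r) = \prod_r G r (k' r) * g.
Proof.
move=> kE GE; rewrite (bigD1 i) //= [in RHS](bigD1 i) //= kE eqxx addn1 GE.
rewrite mulrAC; congr (_ * _ * _); apply: eq_bigr => r /negbTE ri.
by rewrite kE ri addn0.
Qed.

(** The powers of 1 / q produced by inverting theta in the pairs (r, i) with
    r < i cancel the factor q^i that comes from the exponent of q. *)
Lemma An_term_incr (i : 'I_n) (k k' : 'I_n -> nat) (Z := fun r => x r * q ^+ k' r) :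
  (forall r, k r = (k' r + (r == i))%N) ->
  (forall s, s != i -> th (Z i / Z s) != 0) ->
  An_term k = An_term k'
    * \prod_(s | s != i) (th (q * Z i / Z s) / th (Z i / Z s))
    * \prod_s (th (b s * Z i / x s) / th (q * Z i / x s))
    * (th (e * Z i / B) / th (e * Z i)).
Proof.
move=> kE Z0; rewrite /An_term.
have -> : (\sum_(r < n) r * k r = i + \sum_(r < n) r * k' r)%N.
  rewrite (bigD1 i) //= [in RHS](bigD1 i) //= kE eqxx addn1 mulnS addnA.
  by congr (_ + _)%N; apply: eq_bigr => r /negbTE ri; rewrite kE ri addn0.
have -> : \prod_(r < n) \prod_(s < n | (r < s)%N)
      (th (q ^ ((k r)%:Z - (k s)%:Z) * x r / x s) / th (x r / x s)) =
   \prod_(r < n) \prod_(s < n | (r < s)%N)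
      (th (q ^ ((k' r)%:Z - (k' s)%:Z) * x r / x s) / th (x r / x s)) *
   (q^-1 ^+ i * \prod_(s | s != i) (th (q * Z i / Z s) / th (Z i / Z s))).
  rewrite -prod_pairs_at -big_split; apply: eq_bigr => r _ /=.
  rewrite -big_split; apply: eq_bigr => s rs /=.
  have qE (l m : nat) : q ^ (l%:Z - m%:Z) = q ^+ l / q ^+ m.
    by rewrite expfzDr // -exprnN.
  have ZE u v : q ^+ k' u / q ^+ k' v * x u / x v = Z u / Z v.
    by rewrite /Z; field; rewrite expf_neq0 // x0.
  have Zn0 u : Z u != 0 by rewrite /Z mulf_neq0 ?expf_neq0.
  rewrite !qE ZE !kE; have [ri|ri] := eqVneq r i.
    have si : s != i by apply: contraTneq rs => ->; rewrite ri ltnn.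
    rewrite (negbTE si) addn0 addn1 exprS ri.
    rewrite (_ : _ * x i / x s = q * Z i / Z s); last first.
      by rewrite /Z; field; rewrite expf_neq0 // x0.
    have := Z0 _ si; set t := (th (x i / x s))^-1; set t' := th (Z i / Z s).
    by move=> t'0; field.
  have [si|si] := eqVneq s i; last by rewrite !addn0 ZE mulr1.
  rewrite si addn0 addn1.
  have Zri : Z i / Z r != 0 by rewrite mulf_neq0 ?invr_neq0 ?Zn0.
  have t1 : th (Z r / Z i) = - th (Z i / Z r) / (Z i / Z r).
    by rewrite -(theta_like_inv thP) ?invf_div.
  have t2 : th (q ^+ k' r / q ^+ (k' i).+1 * x r / x i) =
      - th (q * Z i / Z r) / (q * (Z i / Z r)).
    rewrite -[q * Z i / Z r]mulrA -(theta_like_inv thP) ?(mulf_neq0 q0) //; congr th.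
    by rewrite /Z exprS; field; rewrite q0 !expf_neq0 // !x0.
  have := Z0 _ ri; rewrite t1 t2.
  set t := (th (x r / x i))^-1; set t' := th (Z i / Z r) => t'0.
  by clearbody Z; field; rewrite t'0 q0 !Zn0.
rewrite (@prod_at i (fun r m => \prod_(s < n)
       ((b s * x r / x s)`_[m] / (q * x r / x s)`_[m]))
       k k' (\prod_s (th (b s * Z i / x s) / th (q * Z i / x s)))) //.
  have -> := prod_at (G := fun r m => (e * x r / B)`_[m] / (e * x r)`_[m])
       (g := (th (e * Z i / B) / th (e * Z i))) kE.
    set g := _ / th (e * Z i); rewrite exprD exprVn.
    by field; rewrite expf_neq0.
  rewrite !tfactS invfM mulrACA /Z; congr (_ * (th _ / th _)); ring.
rewrite -big_split; apply: eq_bigr => s _ /=; rewrite !tfactS invfM mulrACA.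
by rewrite /Z; congr (_ * (th _ / th _)); ring.
Qed.

Variable N : nat.
Implicit Types k : {ffun 'I_n -> 'I_N.+1}.

Definition ffun_incr (i : 'I_n) k : {ffun 'I_n -> 'I_N.+1} :=
  [ffun r => if r == i then inord (k r).+1 else k r].

Definition ffun_decr (i : 'I_n) k : {ffun 'I_n -> 'I_N.+1} :=
  [ffun r => if r == i then inord (k r).-1 else k r].

Lemma ffun_incrE i k : (k i < N)%N ->
  forall r, ffun_incr i k r = (k r + (r == i))%N :> nat.
Proof.
move=> ki r; rewrite ffunE; case: eqP => [->|_]; last by rewrite addn0.
by rewrite inordK // addn1.
Qed.

Lemma sum_ffun_incr i k : (k i < N)%N ->
  (\sum_r ffun_incr i k r = (\sum_r k r).+1)%N.
Proof.
move=> ki; rewrite (bigD1 i) //= [in RHS](bigD1 i) //= ffun_incrE // eqxx addn1.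
rewrite addSn; congr (_ + _).+1.
by apply: eq_bigr => r /negbTE ri; rewrite ffun_incrE // ri addn0.
Qed.

(** Reindexing by raising the i-th part; the compositions whose i-th part is 0 are
    not reached and must not contribute. *)
Lemma sum_incr (i : 'I_n) (K : nat) (G : {ffun 'I_n -> 'I_N.+1} -> F) :
  (K < N)%N -> (forall k, k i = 0%N :> nat -> G k = 0) ->
  \sum_(k : {ffun 'I_n -> 'I_N.+1} | (\sum_r k r)%N == K.+1) G k =
  \sum_(k : {ffun 'I_n -> 'I_N.+1} | (\sum_r k r)%N == K) G (ffun_incr i k).
Proof.
move=> KN G0; rewrite (bigID (fun k => (0 < k i)%N)) /= [X in _ + X]big1 ?addr0.
  (* For k i = N the raised index wraps around to 0; the level K < N excludes
     this case. *)
  rewrite (reindex_onto (ffun_incr i) (ffun_decr i)) /=; last first.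
    move=> k /andP[_ ki]; apply/ffunP => r; apply: val_inj.
    rewrite !ffunE; case: eqP => [->|//]; rewrite inordK prednK ?inord_val //.
    exact: ltnW.
  apply: eq_bigl => k; have [ki|ki] := ltnP (k i) N.
    rewrite sum_ffun_incr // eqSS ffun_incrE // eqxx addn1 andbT andbC.
    rewrite (_ : _ == k = true) //; apply/eqP/ffunP => r; apply: val_inj.
    rewrite !ffunE; case: eqP => [->|//].
    by rewrite (inordK (_ : (k i).+1 < N.+1)%N) // inord_val.
  have -> : ((\sum_r k r)%N == K) = false.
    apply: contraTF ki => /eqP kK; rewrite -ltnNge; apply: leq_ltn_trans KN.
    by rewrite -kK (bigD1 i) //= leq_addr.
  apply/negbTE; rewrite negb_and; apply/orP; left.
  by rewrite negb_and ffunE eqxx /inord /insubd insubN /= ?orbT // -leqNgt ltnS.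
by move=> k /andP[_]; rewrite -eqn0Ngt => /eqP/G0.
Qed.

Local Notation w k := (An_term (fun r => nat_of_ord (k r))).

Hypotheses (x_dist : forall (r s : 'I_n) (i j : nat), (i <= N)%N -> (j <= N)%N ->
    r != s -> th ((x r * q ^+ i) / (x s * q ^+ j)) != 0)
  (qx0 : forall (r s : 'I_n) i, (i < N)%N -> th (q * x r / x s * q ^+ i) != 0)
  (ex0 : forall (r : 'I_n) i, (i < N)%N -> th (e * x r * q ^+ i) != 0).

(** Two interpolations at the points x_r q^(k_r) with the same parameter l = e q^K.
    The first one, with zeros x_r, expands the left side into terms [G i k]; the
    factor theta (Z_i / x_i) kills those with k_i = 0. Lowering k_i turns [G i]
    into [H i], because the choice of l turns theta (l Z_i / q^(K+1)) into the
    denominator theta (e Z_i / q) of the lowered term. The sum of the [H i k] over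
    i is then the second interpolation, with zeros x_r / b_r. *)
Lemma An_sum_rec (K : nat) : (K < N)%N ->
  \sum_(k : {ffun 'I_n -> 'I_N.+1} | (\sum_r k r)%N == K.+1) w k
   * (th (q ^+ K.+1) * \prod_r th (e * x r * q ^+ K)) =
  \sum_(k : {ffun 'I_n -> 'I_N.+1} | (\sum_r k r)%N == K) w k
   * (th (B * q ^+ K) * \prod_r th (e * x r / b r * q ^+ K)).
Proof.
move=> KN; pose l := e * q ^+ K.
have l0 : l != 0 by rewrite mulf_neq0 ?expf_neq0.
pose Z (k : {ffun 'I_n -> 'I_N.+1}) r := x r * q ^+ k r.
have Z0 k r : Z k r != 0 by rewrite mulf_neq0 ?expf_neq0.
have Zd k r s : r != s -> th (Z k r / Z k s) != 0.
  by move=> rs; apply: x_dist; rewrite // -ltnS.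
pose G i k := w k * (th (e * Z k i / q) * \prod_r th (Z k i / x r)
   * \prod_(r | r != i) (th (l * Z k r) / th (Z k i / Z k r))).
pose H i k := w k * (th (e * Z k i / B)
   * \prod_r th (b r * Z k i / x r)
   * \prod_(r | r != i) (th (l * Z k r) / th (Z k i / Z k r))).
have sumZ k : \prod_r Z k r = q ^+ (\sum_r k r)%N * \prod_r x r.
  by rewrite big_split prodrXr mulrC.
transitivity (\sum_i \sum_(k : {ffun 'I_n -> 'I_N.+1} | (\sum_r k r)%N == K.+1) G i k).
  rewrite exchange_big; apply: eq_bigr => k /eqP kK /=.
  rewrite -mulr_sumr; congr (_ * _).
  under eq_bigr => r _ do rewrite mulrAC.
  rewrite (@theta_lagrange_inv _ _ thP _ (Z k) x _ l) ?expf_neq0 //; last 2 first.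
  - exact: Zd.
  - by rewrite sumZ kK.
  apply: eq_bigr => i _; congr (th _ * _ * _).
  by rewrite /l exprS; field; rewrite q0 expf_neq0.
transitivity (\sum_i \sum_(k : {ffun 'I_n -> 'I_N.+1} | (\sum_r k r)%N == K) H i k).
  apply: eq_bigr => i _; rewrite (sum_incr (i := i)) //; last first.
    move=> k ki; rewrite /G (bigD1 i) //= {2}/Z ki expr0 mulr1 divff //.
    by rewrite (theta_like_one thP) mul0r mulr0 mul0r mulr0.
  apply: eq_bigr => k /eqP kK.
  have kiN : (k i < N)%N.
    by apply: leq_ltn_trans KN; rewrite -kK (bigD1 i) //= leq_addr.
  have ZiE : Z (ffun_incr i k) i = q * Z k i.
    by rewrite /Z ffun_incrE // eqxx addn1 exprS mulrCA.
  have ZrE r : r != i -> Z (ffun_incr i k) r = Z k r.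
    by move=> /negbTE ri; rewrite /Z ffun_incrE // ri addn0.
  rewrite /G /H.
  have -> : w (ffun_incr i k) = w k
      * \prod_(s | s != i) (th (q * Z k i / Z k s) / th (Z k i / Z k s))
      * \prod_s (th (b s * Z k i / x s) / th (q * Z k i / x s))
      * (th (e * Z k i / B) / th (e * Z k i)).
    apply: An_term_incr; first exact: ffun_incrE.
    by move=> s si; apply: Zd; rewrite eq_sym.
  have -> : \prod_(r | r != i)
      (th (l * Z k r) / th (Z k i / Z k r)) =
    \prod_(s | s != i) (th (q * Z k i / Z k s) / th (Z k i / Z k s)) *
    \prod_(r | r != i) (th (l * Z (ffun_incr i k) r) /
       th (Z (ffun_incr i k) i / Z (ffun_incr i k) r)).
    rewrite -big_split; apply: eq_bigr => r ri /=.
    have := Zd (ffun_incr i k) i r; rewrite eq_sym => /(_ ri).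
    rewrite ZiE ZrE //; set u := (th (Z k i / _))^-1.
    by set t := th (q * _ / _) => t0; field.
  have -> : \prod_r th (b r * Z k i / x r) =
    \prod_s (th (b s * Z k i / x s) / th (q * Z k i / x s)) *
    \prod_r th (Z (ffun_incr i k) i / x r).
    rewrite -big_split; apply: eq_bigr => r _ /=; rewrite ZiE divfK //.
    by have := qx0 i r kiN; congr (th _ != 0); rewrite /Z; ring.
  have t0 : th (e * Z k i) != 0.
    by have := ex0 i kiN; rewrite -mulrA.
  rewrite (_ : e * Z (ffun_incr i k) i / q = e * Z k i); last first.
    by rewrite ZiE; field.
  by clearbody Z; field.
rewrite exchange_big; apply: eq_bigr => k /eqP kK /=.
rewrite -mulr_sumr; congr (_ * _).
under [in RHS]eq_bigr => r _.
  rewrite (_ : _ * _ = l * (x r / b r)); last by rewrite /l; ring.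
  over.
have B0 : B != 0 by apply/prodf_neq0.
rewrite (@theta_lagrange_inv _ _ thP _ (Z k) (fun r => x r / b r)) //.
- apply: eq_bigr => i _; congr (th _ * _ * _).
    by rewrite /l; field; rewrite B0 expf_neq0.
  by apply: eq_bigr => r _; congr th; field; rewrite x0 b0.
- by rewrite mulf_neq0 ?expf_neq0.
- by move=> r; rewrite mulf_neq0 ?invr_neq0.
- exact: Zd.
by rewrite sumZ kK prodf_div -/B; field.
Qed.

Hypothesis (fq0 : forall i, (i < N)%N -> th (q ^+ i.+1) != 0).

Lemma An_sum (K : nat) : (K <= N)%N ->
  \sum_(k : {ffun 'I_n -> 'I_N.+1} | (\sum_r k r)%N == K) w k =
  B`_[K] * (\prod_r (e * x r / b r)`_[K]) / (q`_[K] * \prod_r (e * x r)`_[K]).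
Proof.
elim: K => [|K IHK] KN.
  rewrite (big_pred1 [ffun=> ord0]) => [|k]; last first.
    rewrite sum_nat_eq0; apply/forallP/eqP => [k0|-> r]; last by rewrite ffunE.
    by apply/ffunP => r; apply: val_inj; rewrite ffunE /=; apply/eqP/(implyP (k0 r)).
  rewrite /An_term !tfact0 big1 => [|r _]; last first.
    rewrite big1 // => s rs; rewrite !ffunE subrr expr0z mul1r divff //.
    have := @x_dist r s 0 0 (leq0n _) (leq0n _); rewrite !expr0 !mulr1; apply.
    by apply: contraTneq rs => ->; rewrite ltnn.
  have t1 (a b' : F) (r : 'I_n) :
      a`_[[ffun=> ord0 : 'I_N.+1] r] / b'`_[[ffun=> ord0 : 'I_N.+1] r] = 1.
    by rewrite ffunE !tfact0 divr1.
  do 2 (rewrite big1; last by move=> r _; rewrite ?big1 // => s _; rewrite t1).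
  rewrite !big1 => [|r _|r _|r _]; rewrite ?ffunE ?tfact0 ?muln0 //.
  by rewrite expr0 !mulr1 divr1.
have := An_sum_rec KN; rewrite -!mulr_suml IHK 1?ltnW // => E.
have t0 : th (q ^+ K.+1) * \prod_r th (e * x r * q ^+ K) != 0.
  by rewrite mulf_neq0 ?fq0 //; apply/prodf_neq0 => r _; apply: ex0.
apply: (mulIf t0); rewrite E !tfactS.
have pS (f : 'I_n -> F) : \prod_r (f r)`_[K.+1] =
    \prod_r (f r)`_[K] * \prod_r th (f r * q ^+ K).
  by rewrite -big_split; apply: eq_bigr => r _; rewrite tfactS.
rewrite !pS -exprS.
move: t0; rewrite mulf_eq0 negb_or => /andP[t0 t0'].
have fn0 (a : F) (L : nat) : (L <= N)%N ->
    (forall i, (i < N)%N -> th (a * q ^+ i) != 0) -> a`_[L] != 0.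
  move=> LN a0; rewrite /tfact big_mkord; apply/prodf_neq0 => i _.
  by apply: a0; apply: leq_trans LN.
have t1 : \prod_r (e * x r)`_[K] != 0.
  by apply/prodf_neq0 => r _; apply: (fn0 _ _ (ltnW KN)) => i; apply: ex0.
have t2 : q`_[K] != 0.
  by apply: (fn0 _ _ (ltnW KN)) => i iN; rewrite -exprS fq0.
by field; rewrite t0 t0' t1.
Qed.

End Multisum.

(** * The Frenkel-Turaev sum *)

Section FrenkelTuraev.
Variables (F : fieldType) (th : F -> F) (thP : theta_like th).
Variables (q : F) (q0 : q != 0).
Local Notation "a `_[ k ]" := (tfact th a q k) (at level 3).

(** The form of the addition formula that is antisymmetric in z1 and z2; it is
    interpolation at two nodes with the denominator theta (z1 / z2) cleared. *)
Lemma theta_addition_sym (a1 a2 a3 z1 z2 : F) :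
  a1 != 0 -> a2 != 0 -> a3 != 0 -> z1 != 0 -> z2 != 0 ->
  th (z1 / z2) * (th (a1 * a2 * (z1 * z2)) * th (a1 * a3 * (z1 * z2))
    * th (a2 * a3 * (z1 * z2))) =
  th (a1 * z1) * th (a2 * z1) * th (a3 * z1) * th (a1 * a2 * a3 * (z1 * z2) * z2)
  - z1 / z2 * (th (a1 * z2) * th (a2 * z2) * th (a3 * z2)
     * th (a1 * a2 * a3 * (z1 * z2) * z1)).
Proof.
move=> a10 a20 a30 z10 z20; apply/eqP; rewrite eq_sym subr_eq; apply/eqP.
have := @theta_like_addition _ _ thP (a3 * z1) (a2 * (z1 * z2)) z1 z2 a1^-1.
rewrite !mulf_neq0 ?invr_neq0 // => /(_ isT isT z10 z20 isT).
rewrite (_ : a3 * z1 * z2 * (a2 * (z1 * z2)) / (a1^-1 * z1) =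
  a1 * a2 * a3 * (z1 * z2) * z2); last by field; rewrite ?oner_eq0 ?a10 ?z10.
rewrite (_ : z1 / a1^-1 = a1 * z1); last by field; rewrite ?oner_eq0 ?a10 ?z10 ?z20.
rewrite (_ : a2 * (z1 * z2) / z2 = a2 * z1); last by field; rewrite ?oner_eq0 ?a10 ?z10 ?z20.
rewrite (_ : a3 * z1 * z2 / a1^-1 = a1 * a3 * (z1 * z2)); last by field; rewrite ?oner_eq0 ?a10 ?z10 ?z20.
rewrite (_ : a3 * z1 * (a2 * (z1 * z2)) / z1 = a2 * a3 * (z1 * z2)); last by field; rewrite ?oner_eq0 ?a10 ?z10 ?z20.
rewrite (_ : a2 * (z1 * z2) / a1^-1 = a1 * a2 * (z1 * z2)); last by field; rewrite ?oner_eq0 ?a10 ?z10 ?z20.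
rewrite (_ : a3 * z1 * z2 / z1 = a3 * z2); last by field; rewrite ?oner_eq0 ?a10 ?z10 ?z20.
rewrite (_ : z2 / a1^-1 = a1 * z2); last by field; rewrite ?oner_eq0 ?a10 ?z10 ?z20.
rewrite (_ : a3 * z1 * (a2 * (z1 * z2)) / a1^-1 = a1 * a2 * a3 * (z1 * z2) * z1);
  last by field; rewrite ?oner_eq0 ?a10 ?z10 ?z20.
rewrite (_ : a2 * (z1 * z2) / z1 = a2 * z2); last by field; rewrite ?oner_eq0 ?a10 ?z10 ?z20.
move=> E; transitivity (th (a3 * z1) * th (a1 * a2 * a3 * (z1 * z2) * z2)
  * th (a1 * z1) * th (a2 * z1)); first by ring.
by rewrite E; ring.
Qed.

Lemma tfactSl a k : a`_[k.+1] = th a * (a * q)`_[k].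
Proof.
rewrite /tfact big_nat_recl // expr0 mulr1; congr (_ * _).
by apply: eq_bigr => j _; rewrite exprS mulrA.
Qed.

Lemma tfact_rev a k : a != 0 ->
  (q / q ^+ k / a)`_[k] = a`_[k] * \prod_(0 <= j < k) (- (a * q ^+ j)^-1).
Proof.
move=> a0; rewrite /tfact big_nat_rev -big_split !big_mkord.
apply: eq_bigr => -[j jk] _ /=.
have aq0 : a * q ^+ j != 0 by rewrite mulf_neq0 ?expf_neq0.
rewrite mulrN -mulNr -(theta_like_inv thP) // add0n; congr th.
have -> : q ^+ k = q * (q ^+ (k - j.+1) * q ^+ j).
  by rewrite -exprD -exprS; congr (_ ^+ _); lia.
by field; rewrite a0 q0 !expf_neq0.
Qed.

Variables (r a1 a2 a3 : F).
Hypotheses (r0 : r != 0) (a10 : a1 != 0) (a20 : a2 != 0) (a30 : a3 != 0).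
Let t := a1 * a2 * a3 / r.

(** The summand of the sum over (i, j) with i + j = K for n = 2, z1 = r, z2 = 1,
    multiplied by a common denominator that depends only on K, and without its
    factor theta (q^i r / q^j). The clearing leaves only theta (q^m), 0 < m <= N,
    in denominators. *)
Definition FT_term (i j : nat) : F :=
  q ^+ j * (q ^+ i.+1 * r)`_[j] * (q ^+ j.+1 / r)`_[i]
  * (q`_[i + j] / (q`_[i] * q`_[j]))
  * (a1`_[i] * a2`_[i] * a3`_[i])
  * ((a1 / r)`_[j] * (a2 / r)`_[j] * (a3 / r)`_[j])
  * ((t * q ^+ i)`_[j] * (t / r * q ^+ j)`_[i]).

Local Notation U := FT_term.

(** The two parts of a term of level K + 1 that come from lowering i, respectively
    j; they vanish when there is nothing to lower. *)
Definition FT_left i j := if i is i'.+1 then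
  U i' j * (th (a1 * q ^+ i') * th (a2 * q ^+ i') * th (a3 * q ^+ i'))
  * th (t / r * q ^+ (i' + j + j)) else 0.
Definition FT_right i j := if j is j'.+1 then
  - (r * q ^+ i / q ^+ j') * U i j' *
  (th (a1 / r * q ^+ j') * th (a2 / r * q ^+ j') * th (a3 / r * q ^+ j'))
  * th (t * q ^+ (i + j' + i)) else 0.

(** The second interpolation of [An_sum_rec] for n = 2, in cleared form. *)
Lemma FT_left_right i j : FT_left i.+1 j + FT_right i j.+1 = U i j * th (q ^+ i * r / q ^+ j)
  * (th (t / a1 * q ^+ (i + j)) * th (t / a2 * q ^+ (i + j))
     * th (t / a3 * q ^+ (i + j))).
Proof.
have qn m : q ^+ m != 0 by rewrite expf_neq0.
have nz u : u != 0 -> u / r != 0 by move=> u0; rewrite mulf_neq0 ?invr_neq0.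
have E := theta_addition_sym (nz _ a10) (nz _ a20) (nz _ a30)
  (mulf_neq0 (qn i) r0) (qn j).
rewrite /FT_left /FT_right.
have e3 : t / a3 * q ^+ (i + j) = a1 / r * (a2 / r) * (q ^+ i * r * q ^+ j).
  by rewrite /t exprD; field; rewrite r0 a30.
have e2 : t / a2 * q ^+ (i + j) = a1 / r * (a3 / r) * (q ^+ i * r * q ^+ j).
  by rewrite /t exprD; field; rewrite r0 a20.
have e1 : t / a1 * q ^+ (i + j) = a2 / r * (a3 / r) * (q ^+ i * r * q ^+ j).
  by rewrite /t exprD; field; rewrite r0 a10.
rewrite e1 e2 e3.
match type of E with _ = ?E' => transitivity (U i j * E'); last by rewrite -E; ring end.
have f1 u z : u / r * (z * r) = u * z by field.
rewrite !f1.
have -> : a1 / r * (a2 / r) * (a3 / r) * (q ^+ i * r * q ^+ j) * q ^+ j =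
   t / r * q ^+ (i + j + j) by rewrite /t !exprD; field.
have -> : a1 / r * (a2 / r) * (a3 / r) * (q ^+ i * r * q ^+ j) * (q ^+ i * r) =
   t * q ^+ (i + j + i) by rewrite /t !exprD; field.
rewrite [r * _]mulrC; ring.
Qed.

Variable N : nat.
Hypothesis thq : forall m, (m < N)%N -> th (q ^+ m.+1) != 0.

Lemma tfact_q_neq0 m : (m <= N)%N -> q`_[m] != 0.
Proof.
move=> mN; rewrite /tfact big_mkord; apply/prodf_neq0 => i _.
by rewrite -exprS; apply: thq; apply: leq_trans mN.
Qed.

(** The first interpolation of [An_sum_rec] for n = 2, in cleared form. For
    i = 0 or j = 0 only one part is present and the formula needs no addition
    formula. *)
Lemma FT_term_split i j : (0 < i + j)%N -> (i + j <= N)%N ->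
  U i j * th (q ^+ i * r / q ^+ j) =
  th (q ^+ (i + j) * r) * th (q ^+ (i + j) / r) * (FT_left i j + FT_right i j).
Proof.
have qn m : q ^+ m != 0 by rewrite expf_neq0.
have fE u v k : u * q ^+ k = v -> u`_[k.+1] = u`_[k] * th v.
  by move=> <-; rewrite tfactS.
have flE u v k : u * q = v -> u`_[k.+1] = th u * v`_[k].
  by move=> <-; rewrite tfactSl.
case: i j => [|i] [|j] // _ ijN.
- rewrite add0n in ijN *; rewrite /FT_left /FT_right /FT_term !tfact0 !add0n !addn0.
  have e : th (q ^+ 0 * r / q ^+ j.+1) = - th (q ^+ j.+1 / r) / (q ^+ j.+1 / r).
    rewrite -(theta_like_inv thP) ?mulf_neq0 ?invr_neq0 //.
    by congr th; rewrite expr0; field; rewrite r0 qn.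
  rewrite e (fE (q ^+ 1 * r) (q ^+ j.+1 * r)); last by rewrite expr1 exprS; ring.
  rewrite (fE (t * q ^+ 0) (t * q ^+ j)); last by rewrite expr0; ring.
  rewrite !(fE _ _ _ erefl).
  have qj := tfact_q_neq0 (ltnW ijN); have tj := thq ijN.
  by rewrite -!exprS !exprS; field; rewrite -exprS tj q0 qj qn r0.
- rewrite addn0 in ijN *; rewrite /FT_left /FT_right /FT_term !tfact0 !addn0.
  rewrite (fE (q ^+ 1 / r) (q ^+ i.+1 / r)); last by rewrite expr1 exprS; ring.
  rewrite (fE (t / r * q ^+ 0) (t / r * q ^+ i)); last by rewrite expr0; ring.
  rewrite !(fE _ _ _ erefl).
  have qj := tfact_q_neq0 (ltnW ijN); have tj := thq ijN.
  by rewrite expr0 divr1 -!exprS; field; rewrite tj qj.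
rewrite !(addSn, addnS) in ijN *.
have t0 : t != 0 by rewrite /t !mulf_neq0 ?invr_neq0.
have t1 : t / (r * q) != 0 by rewrite !mulf_neq0 ?invr_neq0 ?mulf_neq0.
have E := theta_addition_sym (invr_neq0 r0) (oner_neq0 F) t1 (mulf_neq0 (qn i.+1) r0) (qn j.+1).
have {}E : th (q ^+ i.+1 * r / q ^+ j.+1) * (th (q ^+ (i + j).+2)
    * th (t / r * q ^+ (i + j).+1) * th (t * q ^+ (i + j).+1)) =
  th (q ^+ i.+1) * th (q ^+ i.+1 * r) * th (t * q ^+ i)
    * th (t / r * q ^+ (i + j + j).+2)
  - q ^+ i.+1 * r / q ^+ j.+1 * (th (q ^+ j.+1 / r) * th (q ^+ j.+1)
    * th (t / r * q ^+ j) * th (t * q ^+ (i + j + i).+2)).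
  apply: (etrans _ (etrans E _));
    [congr (th _ * (th _ * th _ * th _))
    |congr (th _ * th _ * th _ * th _ - _ * (th _ * th _ * th _ * th _))];
    rewrite ?exprS ?exprD; field; by rewrite ?r0 ?q0 ?qn.
rewrite /FT_left /FT_right /FT_term !(addSn, addnS).
rewrite (fE (q ^+ i.+2 * r) (q ^+ (i + j).+2 * r)); last by rewrite !exprS exprD; ring.
rewrite (fE (q ^+ j.+2 / r) (q ^+ (i + j).+2 / r)); last by rewrite !exprS exprD; ring.
rewrite (flE (q ^+ i.+1 * r) (q ^+ i.+2 * r)); last by rewrite !exprS; ring.
rewrite (flE (q ^+ j.+1 / r) (q ^+ j.+2 / r)); last by rewrite !exprS; ring.
rewrite (fE (t * q ^+ i.+1) (t * q ^+ (i + j).+1)); last by rewrite !exprS exprD; ring.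
rewrite (flE (t * q ^+ i) (t * q ^+ i.+1)); last by rewrite !exprS; ring.
rewrite (fE (t / r * q ^+ j.+1) (t / r * q ^+ (i + j).+1)); last by rewrite !exprS exprD; ring.
rewrite (flE (t / r * q ^+ j) (t / r * q ^+ j.+1)); last by rewrite !exprS; ring.
rewrite !tfactS -!exprS.
have iN : (i < N)%N by rewrite (leq_trans _ ijN) // ltnS leqW // leq_addr.
have jN : (j < N)%N by rewrite (leq_trans _ ijN) // ltnS leqW // leq_addl.
have qi := tfact_q_neq0 (ltnW iN); have qj := tfact_q_neq0 (ltnW jN).
have ti := thq iN; have tj := thq jN.
(* The second factor collects what the three terms have in common. *)
match type of E with ?A = _ => transitivity (A * (
  q ^+ j.+1 * (q ^+ i.+2 * r)`_[j] * th (q ^+ (i + j).+2 * r)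
  * (q ^+ j.+2 / r)`_[i] * th (q ^+ (i + j).+2 / r)
  * (q`_[i + j] * th (q ^+ (i + j).+1)) / (q`_[i] * q`_[j] * th (q ^+ i.+1) * th (q ^+ j.+1))
  * (a1`_[i] * th (a1 * q ^+ i) * (a2`_[i] * th (a2 * q ^+ i)) * (a3`_[i] * th (a3 * q ^+ i)))
  * ((a1 / r)`_[j] * th (a1 / r * q ^+ j) * ((a2 / r)`_[j] * th (a2 / r * q ^+ j))
     * ((a3 / r)`_[j] * th (a3 / r * q ^+ j)))
  * (t * q ^+ i.+1)`_[j] * (t / r * q ^+ j.+1)`_[i])) end.
  by field; rewrite qi qj ti tj.
by rewrite E; field; rewrite qi qj ti tj !qn.
Qed.

Lemma FT_sum K : (K <= N)%N ->
  \sum_(0 <= i < K.+1) U i (K - i) * th (q ^+ i * r / q ^+ (K - i)) =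
  th r * (q * r)`_[K] * (q / r)`_[K]
  * ((t / a1)`_[K] * (t / a2)`_[K] * (t / a3)`_[K]).
Proof.
elim: K => [|K IHK] KN.
  rewrite big_nat1 subnn /FT_term !tfact0 expr0.
  by rewrite !mulr1 !divr1 !mul1r.
have E i : (0 <= i < K.+2)%N -> U i (K.+1 - i) * th (q ^+ i * r / q ^+ (K.+1 - i)) =
    th (q ^+ K.+1 * r) * th (q ^+ K.+1 / r) * (FT_left i (K.+1 - i) + FT_right i (K.+1 - i)).
  move=> /andP[_ iK]; have iE : (i + (K.+1 - i) = K.+1)%N by rewrite subnKC.
  by rewrite FT_term_split iE.
rewrite (eq_big_nat _ _ E) -mulr_sumr big_split /=.
rewrite big_nat_recl //= add0r [X in _ + X]big_nat_recr //= subnn /= addr0.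
rewrite -big_split /= (eq_big_nat _ _ (F2 := fun i =>
  U i (K - i) * th (q ^+ i * r / q ^+ (K - i)) *
  (th (t / a1 * q ^+ K) * th (t / a2 * q ^+ K) * th (t / a3 * q ^+ K)))); last first.
  move=> i /andP[_ iK]; rewrite subSS subSn // -/(FT_left i.+1 _) -/(FT_right i (K - i).+1).
  by rewrite FT_left_right subnKC.
rewrite -mulr_suml IHK ?(ltnW KN) // !tfactS !exprS.
rewrite (_ : q * r * q ^+ K = q * q ^+ K * r); last by ring.
rewrite (_ : q / r * q ^+ K = q * q ^+ K / r); last by ring.
ring.
Qed.

End FrenkelTuraev.

Section Jackson.
Variables (F : fieldType) (th : F -> F) (thP : theta_like th).
Variables (q : F) (q0 : q != 0).
Local Notation "a `_[ k ]" := (tfact th a q k) (at level 3).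
Variables (a b c d : F) (N : nat).
Hypotheses (a0 : a != 0) (b0 : b != 0) (c0 : c != 0) (d0 : d != 0).
Hypothesis thq : forall m, (m < N)%N -> th (q ^+ m.+1) != 0.

Let r := a * q ^+ N.
Let t := b * c * d / r.
Let g := a ^+ 2 * q ^+ N.+1 / (b * c * d).

(** Consecutive cleared terms with i + j = N differ by the ratio of consecutive
    terms of the one-variable sum. Factors indexed by j become factors indexed by k
    through theta (1/z) = - theta z / z, for instance q^(j+1) / r = 1 / (a q^k); the
    monomials combine to q. *)
Lemma FT_term_ratio k j : (k + j.+1)%N = N ->
  th (a * q / b * q ^+ k) != 0 -> th (a * q / c * q ^+ k) != 0 ->
  th (a * q / d * q ^+ k) != 0 -> th (t * q ^+ k) != 0 ->
  th (a * q ^+ N.+1 * q ^+ k) != 0 ->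
  FT_term th q r b c d k.+1 j = FT_term th q r b c d k j.+1 *
  (q * (th (a * q ^+ k) * th (b * q ^+ k) * th (c * q ^+ k) * th (d * q ^+ k)
     * th (g * q ^+ k) * th (q ^- N * q ^+ k))
   / (th (q ^+ k.+1) * th (a * q / b * q ^+ k) * th (a * q / c * q ^+ k)
     * th (a * q / d * q ^+ k) * th (t * q ^+ k) * th (a * q ^+ N.+1 * q ^+ k))).
Proof.
move=> kjN tb tc td tt ta.
have qn m : q ^+ m != 0 by rewrite expf_neq0.
have fE u v m : u * q ^+ m = v -> u`_[m.+1] = u`_[m] * th v.
  by move=> <-; rewrite tfactS.
have flE u v m : u * q = v -> u`_[m.+1] = th u * v`_[m].
  by move=> <-; rewrite tfactSl.
have r0 : r != 0 by rewrite mulf_neq0.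
have inv u v : u != 0 -> u * v = 1 -> th v = - th u / u.
  by move=> u0 uv; rewrite -(theta_like_inv thP) //; congr th; apply: (mulfI u0); rewrite uv divff.
rewrite /FT_term -/t addSn addnS.
rewrite (flE (q ^+ k.+1 * r) (q ^+ k.+2 * r)); last by rewrite !exprS; ring.
rewrite (flE (q ^+ j.+1 / r) (q ^+ j.+2 / r)); last by rewrite !exprS; ring.
rewrite (flE (t * q ^+ k) (t * q ^+ k.+1)); last by rewrite !exprS; ring.
rewrite (flE (t / r * q ^+ j) (t / r * q ^+ j.+1)); last by rewrite !exprS; ring.
rewrite !(fE _ _ _ erefl) -!exprS.
have NE : q ^+ N = q ^+ k * q ^+ j * q by rewrite -kjN addnS exprSr exprD.
have e1 : th (q ^- N * q ^+ k) = - th (q ^+ j.+1) / q ^+ j.+1.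
  by apply: inv => //; rewrite NE exprS; field; rewrite q0 !qn.
have e2 : th (a * q ^+ k) = - th (q ^+ j.+1 / r) / (q ^+ j.+1 / r).
  apply: inv; first by rewrite mulf_neq0 ?invr_neq0.
  by rewrite /r NE exprS; field; rewrite q0 a0 !qn.
have e3 u : u != 0 -> th (a * q / u * q ^+ k) = - th (u / r * q ^+ j) / (u / r * q ^+ j).
  move=> u0; apply: inv; first by rewrite !mulf_neq0 ?invr_neq0.
  by rewrite /r NE; field; rewrite q0 a0 u0 !qn.
have e4 : th (g * q ^+ k) = - th (t / r * q ^+ j) / (t / r * q ^+ j).
  apply: inv; first by rewrite !mulf_neq0 ?invr_neq0 ?mulf_neq0.
  by rewrite /g /t /r [q ^+ N.+1]exprS NE; field; rewrite q0 a0 b0 c0 d0 !qn.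
have e5 : a * q ^+ N.+1 * q ^+ k = q ^+ k.+1 * r by rewrite /r !exprS; ring.
have kN : (k < N)%N by rewrite -kjN addnS ltnS leq_addr.
have jN : (j < N)%N by rewrite -kjN addnS ltnS leq_addl.
have tk := thq kN; have tj := thq jN.
have qk := tfact_q_neq0 thq (ltnW kN); have qj := tfact_q_neq0 thq (ltnW jN).
move: tb tc td ta; rewrite e5 !e3 // !mulf_eq0 !negb_or !oppr_eq0.
move=> /andP[tb _] /andP[tc _] /andP[td _] ta; rewrite e1 e2 e4.
rewrite [q ^+ j.+1]exprS; move: tt; rewrite /t => tt; field.
by rewrite !oppr_eq0 r0 qn d0 c0 b0 ta tt td tc tb tk q0 -exprS tj qk qj.
Qed.

Lemma FT_term_first k : (k <= N)%N ->
  (a * q / b)`_[N] != 0 -> (a * q / c)`_[N] != 0 -> (a * q / d)`_[N] != 0 ->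
  t`_[N] != 0 -> (a * q ^+ N.+1)`_[N] != 0 ->
  FT_term th q r b c d k (N - k) = FT_term th q r b c d 0 N *
  (q ^+ k * (a`_[k] * b`_[k] * c`_[k] * d`_[k] * g`_[k] * (q ^- N)`_[k])
   / (q`_[k] * (a * q / b)`_[k] * (a * q / c)`_[k] * (a * q / d)`_[k]
      * t`_[k] * (a * q ^+ N.+1)`_[k])).
Proof.
move=> + hb hc hd ht ha; elim: k => [|k IHk] kN.
  by rewrite subn0 !tfact0 expr0 !mulr1 divr1 mulr1.
have jE : (k + (N - k.+1).+1 = N)%N by rewrite -subSn // subSS subnKC // ltnW.
rewrite (FT_term_ratio jE) ?(tfact_neq0 _ kN) // -subSn // subSS.
rewrite (IHk (ltnW kN)) -mulrA; congr (_ * _).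
by rewrite !tfactS [q ^+ k.+1]exprS !invfM; ring.
Qed.

(** The elliptic Jackson sum of Frenkel and Turaev: [FT_sum] at level N, divided by
    its first term. Reversing the shifted factorials on both sides produces
    monomials, whose quotient is the power q^N in the first term. *)
Lemma jackson_sum :
  th a != 0 ->
  (a * q / b)`_[N] != 0 -> (a * q / c)`_[N] != 0 -> (a * q / d)`_[N] != 0 ->
  t`_[N] != 0 -> (a * q ^+ N.+1)`_[N] != 0 ->
  \sum_(0 <= k < N.+1) th (a * q ^+ (2 * k)) / th a *
    (q ^+ k * (a`_[k] * b`_[k] * c`_[k] * d`_[k] * g`_[k] * (q ^- N)`_[k])
   / (q`_[k] * (a * q / b)`_[k] * (a * q / c)`_[k] * (a * q / d)`_[k]
      * t`_[k] * (a * q ^+ N.+1)`_[k])) =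
  ((a * q)`_[N] * (a * q / (b * c))`_[N] * (a * q / (b * d))`_[N]
    * (a * q / (c * d))`_[N]) /
  ((a * q / b)`_[N] * (a * q / c)`_[N] * (a * q / d)`_[N]
    * (a * q / (b * c * d))`_[N]).
Proof.
move=> ta hb hc hd ht ha.
have qn m : q ^+ m != 0 by rewrite expf_neq0.
have r0 : r != 0 by rewrite mulf_neq0.
(* m y is the monomial by which reversal changes (y)_N. *)
pose m y := \prod_(0 <= j < N) - (y * q ^+ j)^-1.
have revE u y : u * y * q ^+ N = q -> u`_[N] = y`_[N] * m y.
  move=> uy; have y0 : y != 0.
    by apply: contraNneq q0 => y0; rewrite -uy y0 mulr0 mul0r.
  rewrite -(tfact_rev thP q0) //; congr tfact.
  by apply: (mulIf (mulf_neq0 y0 (qn N))); rewrite mulrA uy; field; rewrite y0 qn.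
have m0 y : y != 0 -> m y != 0.
  move=> y0; rewrite /m big_mkord; apply/prodf_neq0 => j _.
  by rewrite oppr_eq0 invr_neq0 ?mulf_neq0.
have q1 := tfact_q_neq0 thq (leqnn N).
have U0E : FT_term th q r b c d 0 N = q ^+ N * (q * r)`_[N]
    * ((b / r)`_[N] * (c / r)`_[N] * (d / r)`_[N]) * t`_[N].
  by rewrite /FT_term -/t add0n !tfact0 expr0 expr1 !mulr1 mul1r divff // !mulr1.
have qrE : q * r = a * q ^+ N.+1 by rewrite /r exprS mulrCA.
have rE u : u != 0 -> (u / r)`_[N] = (a * q / u)`_[N] * m (a * q / u).
  by move=> u0; apply: revE; rewrite /r; field; rewrite u0 a0 qn.
have tE : t`_[N] = (a * q / (b * c * d))`_[N] * m (a * q / (b * c * d)).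
  by apply: revE; rewrite /t /r; field; rewrite d0 c0 b0 a0 qn.
have hbcd : (a * q / (b * c * d))`_[N] != 0.
  by move: ht; rewrite tE mulf_eq0 negb_or => /andP[].
have mE : m a * m (a * q / (c * d)) * m (a * q / (b * d)) * m (a * q / (b * c)) =
    q ^+ N * (m (a * q / b) * m (a * q / c) * m (a * q / d) * m (a * q / (b * c * d))).
  rewrite -[N in q ^+ N]subn0 -prodr_const_nat -!big_split; apply: eq_bigr => j _ /=.
  by field; rewrite a0 b0 c0 d0 q0 qn.
have U0 : FT_term th q r b c d 0 N * th a != 0.
  by rewrite U0E qrE (rE b) // (rE c) // (rE d) // tE !mulf_neq0 // m0 // !mulf_neq0 // invr_neq0 ?mulf_neq0.
apply: (mulfI U0); rewrite mulr_sumr.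
transitivity (th r * (q * r)`_[N] * (q / r)`_[N] *
   ((t / b)`_[N] * (t / c)`_[N] * (t / d)`_[N])).
  rewrite -(FT_sum thP q0 r0 b0 c0 d0 thq (leqnn N)); apply: eq_big_nat => k /andP[_ kN].
  rewrite FT_term_first // (_ : _ * r / _ = a * q ^+ (2 * k)); last first.
    rewrite /r -[in q ^+ N](@subnK k N) // mul2n -addnn !exprD.
    by field.
  set v := _ / (q`_[k] * _ * _ * _ * _ * _).
  by field.
have -> : (q / r)`_[N] = a`_[N] * m a by apply: revE; rewrite /r; field; rewrite a0 qn.
have tbE : (t / b)`_[N] = (a * q / (c * d))`_[N] * m (a * q / (c * d)).
  by apply: revE; rewrite /t /r; field; rewrite d0 c0 b0 a0 qn.
have tcE : (t / c)`_[N] = (a * q / (b * d))`_[N] * m (a * q / (b * d)).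
  by apply: revE; rewrite /t /r; field; rewrite d0 c0 b0 a0 qn.
have tdE : (t / d)`_[N] = (a * q / (b * c))`_[N] * m (a * q / (b * c)).
  by apply: revE; rewrite /t /r; field; rewrite d0 c0 b0 a0 qn.
rewrite tbE tcE tdE U0E (rE b) // (rE c) // (rE d) // tE.
have aE : a`_[N] * th r = th a * (a * q)`_[N] by rewrite -tfactS tfactSl.
transitivity (a`_[N] * th r * ((q * r)`_[N] * ((a * q / (c * d))`_[N] *
   (a * q / (b * d))`_[N] * (a * q / (b * c))`_[N])) *
   (m a * m (a * q / (c * d)) * m (a * q / (b * d)) * m (a * q / (b * c)))).
  by ring.
by rewrite aE mE; field; rewrite hb hc hd hbcd.
Qed.

End Jackson.

(** * The multiple Jackson sum over a field *)

Definition tfacts (F : fieldType) (th : F -> F) (s : seq F) (q : F) (k : nat) : F :=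
  \prod_(a <- s) tfact th a q k.

(** Fixing |k| = K and summing with [An_sum] cancels all factors with x and e
    against those outside the inner sum, except for (B)_K / (q)_K, the factor that is
    missing in the one-variable sum. *)
Lemma multi_jackson (F : fieldType) (th : F -> F) (q : F) (n N : nat)
  (a c d e : F) (b x : 'I_n -> F) :
  let B : F := \prod_(r < n) b r in
  (1 <= n)%N ->
  theta_like th -> q != 0 ->
  a != 0 -> c != 0 -> d != 0 -> e != 0 ->
  (forall r, b r != 0) -> (forall r, x r != 0) ->
  (forall r s : 'I_n, (r < s)%N -> th (x r / x s) != 0) ->
  (forall (r s : 'I_n) (m : nat), (m <= N)%N ->
     tfact th (q * x r / x s) q m != 0) ->
  th a != 0 ->
  (forall m : nat, (m <= N)%N ->
     tfacts th [:: a * q / B; a * q / c; a * q / d;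
                 B * c * d * q ^- N / a; a * q ^+ N.+1] q m != 0) ->
  (forall (r : 'I_n) (m : nat), (m <= N)%N -> tfact th (e * x r) q m != 0) ->
  (forall (r : 'I_n) (m : nat), (m <= N)%N ->
     tfact th (e * x r / b r) q m != 0) ->
  \sum_(k : {ffun 'I_n -> 'I_N.+1} | (\sum_(r < n) k r <= N)%N)
    (let K : nat := (\sum_(r < n) k r)%N in
     (\prod_(r < n) \prod_(s < n | (r < s)%N)
        (th (q ^ ((k r : nat)%:Z - (k s : nat)%:Z) * x r / x s)
         / th (x r / x s)))
     * (\prod_(r < n) \prod_(s < n)
          (tfact th (b s * x r / x s) q (k r)
           / tfact th (q * x r / x s) q (k r)))
     * (th (a * q ^+ (2 * K)) / th a)
     * (tfacts th [:: a; c; d; a ^+ 2 * q ^+ N.+1 / (B * c * d); q ^- N] q K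
        / tfacts th [:: a * q / B; a * q / c; a * q / d;
                      B * c * d * q ^- N / a; a * q ^+ N.+1] q K)
     * (\prod_(r < n)
          ((tfact th (e * x r / B) q (k r) * tfact th (e * x r) q K)
           / (tfact th (e * x r) q (k r) * tfact th (e * x r / b r) q K)))
     * q ^+ (\sum_(r < n) r.+1 * k r)%N)
  = tfacts th [:: a * q; a * q / (B * c); a * q / (B * d); a * q / (c * d)] q N
    / tfacts th [:: a * q / B; a * q / c; a * q / d; a * q / (B * c * d)] q N.
Proof.
move=> B n1 thP q0 a0 c0 d0 e0 b0 x0 Hx Hq Ha Hden He Heb.
have B0 : B != 0 by apply/prodf_neq0.
have thI z : z != 0 -> th z != 0 -> th z^-1 != 0.
  by move=> z0 tz; rewrite (theta_like_inv thP) // mulf_neq0 ?oppr_eq0 ?invr_neq0.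
have qx0 (r s : 'I_n) i : (i < N)%N -> th (q * x r / x s * q ^+ i) != 0.
  by move=> iN; have := Hq r s N (leqnn N) => /tfact_neq0; apply.
have ex0 (r : 'I_n) i : (i < N)%N -> th (e * x r * q ^+ i) != 0.
  by move=> iN; have := He r N (leqnn N) => /tfact_neq0; apply.
have fq0 i : (i < N)%N -> th (q ^+ i.+1) != 0.
  by move=> iN; have := qx0 (Ordinal n1) (Ordinal n1) i iN; rewrite mulfK // -exprS.
have qn m : q ^+ m != 0 by rewrite expf_neq0.
(* Since |i - j| <= N, the ratio is q^(i-j) x_r / x_s with a nonzero theta value
   among the given ones, up to inversion. *)
have x_dist (r s : 'I_n) (i j : nat) : (i <= N)%N -> (j <= N)%N ->
    r != s -> th ((x r * q ^+ i) / (x s * q ^+ j)) != 0.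
  have up (r' s' : 'I_n) (i' j' : nat) : (i' <= N)%N -> (j' < i')%N ->
      th ((x r' * q ^+ i') / (x s' * q ^+ j')) != 0.
    move=> iN ji.
    have qi : q ^+ i' = q * q ^+ (i' - j'.+1) * q ^+ j'.
      by rewrite -exprS -exprD; congr (_ ^+ _); lia.
    rewrite (_ : _ / _ = q * x r' / x s' * q ^+ (i' - j'.+1)); last first.
      by rewrite qi; field; rewrite x0 qn.
    by apply: qx0; lia.
  move=> iN jN rs; have nz (r' s' : 'I_n) (i' j' : nat) :
      x r' * q ^+ i' / (x s' * q ^+ j') != 0.
    by rewrite !mulf_neq0 ?invr_neq0 ?mulf_neq0.
  case: (ltngtP i j) => [ij|ji|<-]; last 1 first.
  - rewrite (_ : _ / _ = x r / x s); last by field; rewrite x0 qn.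
    case: (ltngtP r s) => [lrs|lsr|/val_inj ers]; first exact: Hx.
      by rewrite -invf_div; apply: thI; [rewrite mulf_neq0 ?invr_neq0 | apply: Hx].
    by rewrite ers eqxx in rs.
  - by rewrite -invf_div; apply: thI => //; apply: up.
  by apply: up.
pose w (k : {ffun 'I_n -> 'I_N.+1}) := An_term th q x b e (fun r => k r).
pose g := a ^+ 2 * q ^+ N.+1 / (B * c * d).
pose t := B * c * d / (a * q ^+ N).
(* The part of the summand that depends on |k| only. *)
pose cst K := (\prod_r tfact th (e * x r) q K / \prod_r tfact th (e * x r / b r) q K)
  * (th (a * q ^+ (2 * K)) / th a) * (q ^+ K *
   (tfact th a q K * tfact th c q K * tfact th d q K * tfact th g q K
     * tfact th (q ^- N) q K)
   / (tfact th (a * q / B) q K * tfact th (a * q / c) q K * tfact th (a * q / d) q K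
      * tfact th t q K * tfact th (a * q ^+ N.+1) q K)).
have tE : B * c * d * q ^- N / a = t by rewrite /t; field; rewrite a0 qn.
transitivity (\sum_(k : {ffun 'I_n -> 'I_N.+1} | (\sum_(r < n) k r <= N)%N)
    w k * cst (\sum_(r < n) k r)%N).
  apply: eq_bigr => k _; cbv zeta; set K := (\sum_(r < n) k r)%N.
  have -> : (\sum_(r < n) r.+1 * k r = \sum_(r < n) r * k r + K)%N.
    by rewrite /K -big_split; apply: eq_bigr => r _; rewrite mulSn addnC.
  rewrite /tfacts !big_cons !big_nil tE -/g exprD.
  have -> : \prod_(r < n)
      (tfact th (e * x r / B) q (k r) * tfact th (e * x r) q K /
       (tfact th (e * x r) q (k r) * tfact th (e * x r / b r) q K)) =
    \prod_(r < n) (tfact th (e * x r / B) q (k r) / tfact th (e * x r) q (k r)) *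
    (\prod_r tfact th (e * x r) q K / \prod_r tfact th (e * x r / b r) q K).
    rewrite -prodf_div -big_split; apply: eq_bigr => r _ /=.
    by rewrite invfM; ring.
  rewrite /w /An_term /cst !invfM !mulr1 !invr1 !mulr1.
  by rewrite -/B; ring.
rewrite (partition_big (fun k : {ffun 'I_n -> 'I_N.+1} => inord (\sum_(r < n) k r)%N : 'I_N.+1) predT) //=.
transitivity (\sum_(K < N.+1) (\sum_(k : {ffun 'I_n -> 'I_N.+1} | (\sum_r k r)%N == K) w k) * cst K).
  apply: eq_bigr => K _; rewrite mulr_suml.
  rewrite (eq_bigl (fun k : {ffun 'I_n -> 'I_N.+1} => (\sum_r k r)%N == K)).
    by apply: eq_bigr => k /eqP->.
  move=> k; apply/andP/eqP => [[kN /eqP <-]|kK]; first by rewrite inordK.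
  by rewrite kK -ltnS ltn_ord inord_val.
have An K : (K <= N)%N -> _ := An_sum thP q0 x0 b0 e0 x_dist qx0 ex0 fq0 (K := K).
have [hB [hc [hd [ht ha]]]] : tfact th (a * q / B) q N != 0 /\
   tfact th (a * q / c) q N != 0 /\ tfact th (a * q / d) q N != 0 /\
   tfact th t q N != 0 /\ tfact th (a * q ^+ N.+1) q N != 0.
  have := Hden N (leqnn N); rewrite /tfacts !big_cons big_nil mulr1 tE.
  by rewrite !mulf_eq0 !negb_or => /and5P[-> -> -> -> ->].
rewrite /tfacts !big_cons !big_nil !mulr1 !mulrA.
rewrite -(jackson_sum thP q0 a0 B0 c0 d0 fq0 Ha hB hc hd ht ha) big_mkord.
apply: eq_bigr => -[K KN] _; rewrite An // /cst -/g -/t -/B /=.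
have nzp (f : 'I_n -> F) : (forall r, tfact th (f r) q K != 0) ->
    \prod_r tfact th (f r) q K != 0.
  by move=> f0; apply/prodf_neq0 => r _.
have n2 := nzp (fun r => e * x r) (fun r => He r K KN).
have n3 := nzp (fun r => e * x r / b r) (fun r => Heb r K KN).
rewrite !invfM.
match goal with |- _ = ?rhs => transitivity
  ((\prod_(r < n) tfact th (e * x r) q K / \prod_(r < n) tfact th (e * x r) q K)
   * (\prod_(r < n) tfact th (e * x r / b r) q K / \prod_(r < n) tfact th (e * x r / b r) q K)
   * rhs) end; first by ring.
by rewrite !divff // !mul1r.
Qed.

(** * Convergence and zeros of the theta product *)

Local Open Scope classical_set_scope.

Lemma cvgK_unique (K : numFieldType) (u : nat -> K) (z1 z2 : K) :
  u n @[n --> \oo] --> z1 -> u n @[n --> \oo] --> z2 -> z1 = z2.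
Proof.
by move=> u1 u2; rewrite -(cvg_lim _ u1) // -(cvg_lim _ u2).
Qed.

Section Theta.
Variable R : realType.
Local Notation C := R[i].
Local Notation N := (@Normc.normc R).
Implicit Types (z : C) (u : nat -> C).

Lemma normCE z : `|z| = (N z)%:C%C.
Proof. by case: z. Qed.

Lemma normc_nonneg z : 0 <= N z.
Proof. by rewrite -lecR -normCE normr_ge0. Qed.

Lemma ler_normc_add z1 z2 : N (z1 + z2) <= N z1 + N z2.
Proof. exact: le_normcD. Qed.

Lemma normc_opp z : N (- z) = N z. Proof. exact: normcN. Qed.

Lemma normc_exp z k : N (z ^+ k) = N z ^+ k.
Proof. by elim: k => [|k IH]; rewrite ?Normc.normc1 // !exprS Normc.normcM IH. Qed.

Lemma normc_pos z : z != 0 -> 0 < N z.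
Proof.
move=> z0; rewrite lt_def normc_nonneg andbT; apply: contra_neq z0.
exact: Normc.eq0_normc.
Qed.

Lemma ler_normc_sum (I : Type) (r : seq I) (P : pred I) (f : I -> C) :
  N (\sum_(i <- r | P i) f i) <= \sum_(i <- r | P i) N (f i).
Proof.
elim/big_rec2: _ => [|i x y _ xy]; first by rewrite Normc.normc0.
by apply: le_trans (ler_normc_add _ _) _; rewrite lerD2l.
Qed.

(** Limits in the complex field, where norms are complex numbers, are reduced to
    real limits. *)
Lemma cvgCP u z :
  u n @[n --> \oo] --> (z : (C : numFieldType)) <->
  N (u n - z) @[n --> \oo] --> (0 : R).
Proof.
split => uz.
  apply/cvgrPdist_lt => e e0; near=> n.
  rewrite sub0r normrN ger0_norm ?normc_nonneg // -ltcR -normCE distrC.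
  by near: n; apply: ((@cvgrPdist_lt C (C : numFieldType) _ _ _ u z).1 uz); rewrite ltcR.
apply/(@cvgrPdist_lt C (C : numFieldType) _ _ _ u z) => e e0.
have eE : e = (complex.Re e)%:C%C.
  by move: e0; case: e => a b; rewrite ltcE /= => /andP[/eqP->].
have e0' : 0 < complex.Re e by rewrite -ltcR -eE.
near=> n; rewrite distrC normCE eE ltcR.
have : `|0 - N (u n - z)| < complex.Re e by near: n; apply: ((cvgrPdist_lt _ _).1 uz).
by rewrite sub0r normrN ger0_norm ?normc_nonneg.
Unshelve. all: by end_near. Qed.

Lemma cvg_real_geom (v : nat -> R) (K rho : R) : 0 <= rho < 1 ->
  (forall n, `|v n.+1 - v n| <= K * rho ^+ n) -> cvgn v.
Proof.
move=> /andP[rho0 rho1] vK.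
have -> : v = (fun n => v 0%N + series (telescope v) n).
  by apply/funext => n; rewrite telescopeK /= addrC subrK.
apply: is_cvgD; first exact: is_cvg_cst.
apply: normed_cvg; apply: (series_le_cvg (v_ := fun n => K * rho ^+ n)) => //.
- by move=> n /=; apply: normr_ge0.
- by move=> n; apply: le_trans (vK n).
- by apply: (@is_cvg_geometric_series _ K rho); rewrite ger0_norm.
Qed.

(** Completeness of the complex numbers in the only form needed: real and
    imaginary parts are absolutely convergent telescoping series. *)
Lemma cvgC_geom u (K rho : R) : 0 <= rho < 1 ->
  (forall n, N (u n.+1 - u n) <= K * rho ^+ n) ->
  exists z, u n @[n --> \oo] --> (z : (C : numFieldType)).
Proof.
move=> rho1 uK.
have ReN z : `|complex.Re z| <= N z.
  by rewrite -lecR -normCE; apply: le_trans (normc_ge_Re z).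
have ImN z : `|complex.Im z| <= N z.
  case: z => x y /=; rewrite -sqrtr_sqr ler_wsqrtr // lerDr; exact: sqr_ge0.
have /cvg_ex[/= x vx] : cvgn (fun n => complex.Re (u n)).
  apply: (cvg_real_geom rho1) => n; apply: le_trans (uK n).
  by apply: le_trans (ReN _); case: (u _) (u n) => ? ? [].
have /cvg_ex[/= y vy] : cvgn (fun n => complex.Im (u n)).
  apply: (cvg_real_geom rho1) => n; apply: le_trans (uK n).
  by apply: le_trans (ImN _); case: (u _) (u n) => ? ? [].
exists (x +i* y)%C; apply/cvgCP.
apply: (@squeeze_cvgr _ _ _ _ (fun=> 0)
    (fun n => `|complex.Re (u n) - x| + `|complex.Im (u n) - y|)).
- near=> n; rewrite normc_nonneg /=; case: (u n) => a b /=.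
  rewrite -[leRHS]ger0_norm ?addr_ge0 // -[leRHS]sqrtr_sqr ler_wsqrtr //.
  rewrite [leRHS]sqrrD !real_normK ?num_real // lerD2r lerDl mulrn_wge0 //.
- exact: cvg_cst.
rewrite [X in _ --> X](_ : 0 = `|x - x| + `|y - y|); last first.
  by rewrite !subrr normr0 addr0.
by apply: cvgD; apply: cvg_norm; apply: cvgB => //; apply: cvg_cst.
Unshelve. all: by end_near. Qed.

Implicit Types (a p : C).

Lemma cvgC_unique u (z1 z2 : C) :
  u n @[n --> \oo] --> (z1 : (C : numFieldType)) ->
  u n @[n --> \oo] --> (z2 : (C : numFieldType)) -> z1 = z2.
Proof. exact: cvgK_unique. Qed.

Definition theta_part a p (m : nat) : C :=
  \prod_(0 <= j < m) ((1 - a * p ^+ j) * (1 - p ^+ j.+1 / a)).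

(** The j-th factor of the product is 1 minus this quantity. *)
Definition theta_defect a p j : C :=
  a * p ^+ j + p ^+ j.+1 / a - a * p ^+ j * (p ^+ j.+1 / a).

Lemma theta_partS a p m :
  theta_part a p m.+1 = theta_part a p m * (1 - theta_defect a p m).
Proof. by rewrite /theta_part big_nat_recr //=; congr (_ * _); rewrite /theta_defect; ring. Qed.

(** With t = |a|, this is a constant A such that the j-th defect is at most
    A |p|^j. *)
Definition theta_size (t : R) := t + t^-1 + 1.

Lemma theta_size_ge0 t : 0 <= t -> 0 <= theta_size t.
Proof. by move=> t0; rewrite /theta_size !addr_ge0 ?invr_ge0. Qed.

Section Convergence.
Variable p : C.
Hypothesis p1 : `|p| < 1.
Let rho := N p.

Let rho01 : 0 <= rho < 1.
Proof. by rewrite normc_nonneg /= -ltcR -normCE. Qed.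

Lemma theta_defect_le a j : N (theta_defect a p j) <= theta_size (N a) * rho ^+ j.
Proof.
have /andP[r0 /ltW r1] := rho01.
have rS : rho ^+ j.+1 <= rho ^+ j by rewrite exprSr ler_piMr ?exprn_ge0.
have rj1 : rho ^+ j <= 1 by rewrite exprn_ile1.
have rj0 : 0 <= rho ^+ j by rewrite exprn_ge0.
apply: le_trans (ler_normc_add _ _) _; rewrite normc_opp.
have [->|a0] := eqVneq a 0.
  rewrite invr0 !mul0r mulr0 add0r Normc.normc0 add0r.
  by rewrite mulr_ge0 ?theta_size_ge0.
rewrite /theta_size 2!mulrDl lerD //.
  apply: le_trans (ler_normc_add _ _) _; rewrite !Normc.normcM !normc_exp -/rho lerD //.
  by rewrite Normc.normcV mulrC ler_wpM2l ?invr_ge0 ?normc_nonneg.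
rewrite (_ : a * _ * _ = p ^+ j * p ^+ j.+1); last by field.
rewrite mul1r Normc.normcM !normc_exp -/rho mulrC.
by rewrite ler_piMl // (le_trans rS).
Qed.

Definition theta_bound (s : R) := expR (s / (1 - rho)).

(** By 1 + u <= exp u and the geometric series. *)
Lemma prod_theta_bound (s : R) m : 0 <= s ->
  \prod_(0 <= j < m) (1 + s * rho ^+ j) <= theta_bound s.
Proof.
have /andP[r0 r1] := rho01; move=> s0.
have sm : \sum_(0 <= j < m) s * rho ^+ j <= s / (1 - rho).
  rewrite -mulr_sumr ler_wpM2l // -[leRHS]mul1r ler_pdivlMr ?subr_gt0 // big_mkord.
  rewrite (_ : _ * _ = 1 - rho ^+ m); first by rewrite lerBlDl lerDr exprn_ge0.
  by rewrite -[LHS]opprK -mulrN opprB mulrC -subrX1 opprB.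
apply: (le_trans (y := expR (\sum_(0 <= j < m) s * rho ^+ j))); last by rewrite ler_expR.
rewrite expR_sum; apply: ler_prod => j _; rewrite expR_ge1Dx andbT.
by rewrite addr_ge0 // mulr_ge0 // exprn_ge0.
Qed.

Lemma theta_part_le a m : N (theta_part a p m) <= theta_bound (theta_size (N a)).
Proof.
apply: le_trans (prod_theta_bound m (theta_size_ge0 (normc_nonneg a))).
elim: m => [|m IHm]; first by rewrite /theta_part !big_nil Normc.normc1.
rewrite theta_partS Normc.normcM big_nat_recr //= ler_pM ?normc_nonneg //.
apply: le_trans (ler_normc_add _ _) _; rewrite normc_opp Normc.normc1 lerD2l.
exact: theta_defect_le.
Qed.

Lemma cvg_theta a : theta_part a p n @[n --> \oo] --> (theta a p : (C : numFieldType)).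
Proof.
have [z pz] : exists z, theta_part a p n @[n --> \oo] --> (z : (C : numFieldType)).
  apply: (cvgC_geom (K := theta_bound (theta_size (N a)) * theta_size (N a)) rho01).
  move=> n; rewrite theta_partS mulrBr mulr1 addrAC subrr sub0r normc_opp Normc.normcM.
  by rewrite -mulrA ler_pM ?normc_nonneg // ?theta_part_le ?theta_defect_le.
rewrite (_ : theta a p = z) //; apply: cvg_lim => //.
Qed.

Lemma cvg_exp_nome : p ^+ n @[n --> \oo] --> (0 : (C : numFieldType)).
Proof.
apply/cvgCP; under eq_fun do rewrite subr0 normc_exp.
by apply: cvg_expr; rewrite ger0_norm; case/andP: rho01.
Qed.

(** For the direct implication: if no factor vanishes, choose J
    such that the defects from J on sum to at most 1/2; since
    (1 - s)(1 - t) >= 1 - s - t, the products beyond J stay above half of the norm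
    of the J-th one. *)
Lemma theta_eq0P a : a != 0 -> theta a p = 0 <->
  exists j, (1 - a * p ^+ j) * (1 - p ^+ j.+1 / a) = 0.
Proof.
move=> a0; have [r0 r1] := andP rho01; split; last first.
  case=> j fj; apply: (@cvgC_unique (theta_part a p)); first exact: cvg_theta.
  apply/cvgCP; apply: cvg_near_cst; near=> n.
  have jn : (j < n)%N by near: n; exact: nbhs_infty_gt.
  rewrite subr0 /theta_part (big_cat_nat (leq0n j) (ltnW jn)) /=.
  by rewrite [X in _ * X]big_ltn // fj mul0r mulr0 Normc.normc0.
move=> th0; apply: contrapT => nz.
have {}nz j : 1 - theta_defect a p j != 0.
  apply/eqP => dj; apply: nz; exists j; rewrite -dj /theta_defect; ring.
pose A := theta_size (N a); have A0 : 0 <= A by rewrite theta_size_ge0 ?normc_nonneg.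
have [J AJ] : exists J, A * rho ^+ J / (1 - rho) <= 2^-1.
  have : (A / (1 - rho)) * rho ^+ n @[n --> \oo] --> (0 : R).
    by apply: cvg_geometric; rewrite ger0_norm.
  move/cvgrPdist_le => /(_ 2^-1); rewrite invr_gt0 ltr0n => /(_ isT)[J _ /(_ J)].
  rewrite /= leqnn sub0r normrN => /(_ isT) H; exists J.
  by rewrite mulrAC; apply: le_trans H; apply: ler_norm.
have TJ : 0 < N (theta_part a p J).
  apply: normc_pos; elim: (J) => [|k IHk]; first by rewrite /theta_part big_nil oner_eq0.
  by rewrite theta_partS mulf_neq0.
pose s k := A * rho ^+ J * \sum_(i < k) rho ^+ i.
have s_half k : s k <= 2^-1.
  apply: le_trans AJ; rewrite /s; apply: ler_wpM2l; first by rewrite mulr_ge0 ?exprn_ge0.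
  rewrite -[leRHS]mul1r ler_pdivlMr ?subr_gt0 //.
  rewrite (_ : _ * _ = 1 - rho ^+ k); first by rewrite lerBlDl lerDr exprn_ge0.
  by rewrite -[LHS]opprK -mulrN opprB mulrC -subrX1 opprB.
have lower k : N (theta_part a p J) * (1 - s k) <= N (theta_part a p (J + k)).
  elim: k => [|k IHk]; first by rewrite addn0 /s big_ord0 mulr0 subr0 mulr1.
  rewrite addnS theta_partS Normc.normcM.
  have uk : 1 - A * rho ^+ (J + k) <= N (1 - theta_defect a p (J + k)).
    rewrite lerBlDr; apply: (le_trans (y := N (1 - theta_defect a p (J + k)) + N (theta_defect a p (J + k)))).
      rewrite -[X in X <= _](@Normc.normc1 R).
      by apply: le_trans (ler_normc_add _ _); rewrite subrK.
    by rewrite lerD2l theta_defect_le.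
  apply: (le_trans (y := N (theta_part a p (J + k)) * (1 - A * rho ^+ (J + k)))); last first.
    by rewrite ler_wpM2l ?normc_nonneg.
  have t0 : 0 <= A * rho ^+ (J + k) by rewrite mulr_ge0 // exprn_ge0.
  have sk0 : 0 <= s k by rewrite mulr_ge0 ?mulr_ge0 ?exprn_ge0 // sumr_ge0 // => i _; rewrite exprn_ge0.
  have sS : s k.+1 = s k + A * rho ^+ (J + k).
    by rewrite /s big_ord_recr /= exprD; ring.
  have := s_half k.+1; rewrite sS => hS.
  apply: (le_trans (y := N (theta_part a p J) * (1 - s k) * (1 - A * rho ^+ (J + k)))).
    rewrite -mulrA ler_pM2l //; nra.
  by rewrite ler_wpM2r //; nra.
have : N (theta_part a p n) @[n --> \oo] --> (0 : R).
  have /cvgCP := @cvg_theta a; rewrite th0.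
  by under eq_fun do rewrite subr0.
move/cvgrPdist_lt => /(_ (N (theta_part a p J) / 2)); rewrite divr_gt0 // => /(_ isT).
case=> M _ /(_ (J + M)%N); rewrite /= leq_addl sub0r normrN ger0_norm ?normc_nonneg // => /(_ isT).
apply/negP; rewrite -leNgt; apply: le_trans (lower M).
by rewrite ler_pM2l //; have := s_half M; lra.
Unshelve. all: by end_near. Qed.

Lemma theta1 : theta 1 p = 0.
Proof. by apply/theta_eq0P; rewrite ?oner_eq0 //; exists 0%N; rewrite expr0 mulr1 subrr mul0r. Qed.

(** The truncated products at a and 1/a differ by shifting one factor at each end,
    and the factors at the far end tend to 1. *)
Lemma thetaV a : a != 0 -> theta a^-1 p = - theta a p / a.
Proof.
move=> a0; have [->|a1] := eqVneq a 1.
  by rewrite invr1 theta1 oppr0 mul0r.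
have E m : theta_part a^-1 p m * ((1 - a) * (1 - p ^+ m / a)) =
    (1 - a^-1) * (1 - a * p ^+ m) * theta_part a p m.
  elim: m => [|m IHm].
    by rewrite /theta_part !big_nil expr0; field.
  rewrite /theta_part !big_nat_recr //= -/(theta_part _ _ _) -/(theta_part a _ _) invrK.
  transitivity (theta_part a^-1 p m * ((1 - a) * (1 - p ^+ m / a)) *
     ((1 - p ^+ m.+1 * a) * (1 - p ^+ m.+1 / a))); first by ring.
  by rewrite IHm; ring.
have H1 : theta_part a^-1 p n * ((1 - a) * (1 - p ^+ n / a)) @[n --> \oo] -->
    (theta a^-1 p * ((1 - a) * (1 - 0 / a)) : (C : numFieldType)).
  apply: cvgM; first exact: cvg_theta.
  apply: cvgMr; apply: cvgB; first exact: cvg_cst.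
  by apply: cvgMl; apply: cvg_exp_nome.
have H2 : (1 - a^-1) * (1 - a * p ^+ n) * theta_part a p n @[n --> \oo] -->
    ((1 - a^-1) * (1 - a * 0) * theta a p : (C : numFieldType)).
  apply: cvgM; last exact: cvg_theta.
  apply: cvgMr; apply: cvgB; first exact: cvg_cst.
  by apply: cvgMr; apply: cvg_exp_nome.
have H12 : theta a^-1 p * (1 - a) = (1 - a^-1) * theta a p.
  have := H2; under eq_fun do rewrite -E.
  by move/(cvgC_unique H1); rewrite mul0r mulr0 !subr0 !mulr1.
have a1' : 1 - a != 0 by rewrite subr_eq0 eq_sym.
by apply: (mulIf a1'); rewrite H12; field.
Qed.

(** The zeros are the integral powers of p, a group (for p = 0, just 1). *)
Lemma theta_zero_div a b : a != 0 -> b != 0 ->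
  theta a p = 0 -> theta b p = 0 -> theta (a / b) p = 0.
Proof.
have [p0|p0] := eqVneq p 0.
  have one z : z != 0 -> theta z p = 0 -> z = 1.
    move=> z0 /(theta_eq0P z0)[j]; rewrite p0 [0 ^+ j.+1]exprS mul0r mul0r subr0 mulr1.
    case: j => [|j]; first by rewrite expr0 mulr1 => /eqP; rewrite subr_eq0 => /eqP.
    by rewrite exprS mul0r mulr0 subr0 => /eqP; rewrite oner_eq0.
  by move=> a0 b0 /(one _ a0)-> /(one _ b0)->; rewrite divr1 theta1.
have powP z : z != 0 -> theta z p = 0 <-> exists k : int, z = p ^ k.
  move=> z0; split => [/(theta_eq0P z0)[j /eqP]|[k zE]].
    rewrite mulf_eq0 !subr_eq0 => /orP[]/eqP zj.
      exists (- j%:Z); apply: (mulIf (expf_neq0 j p0)).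
      by rewrite -zj -exprnN mulVf // expf_neq0.
    by exists j.+1; rewrite -[z]mul1r zj divfK.
  apply/(theta_eq0P z0); case: k zE => j zE.
    case: j zE => [|j] zE; first by exists 0%N; rewrite zE expr0z expr0 mulr1 subrr mul0r.
    by exists j; rewrite zE -exprnP divff ?expf_neq0 // subrr mulr0.
  exists j.+1; rewrite zE NegzE -exprnN mulVf ?expf_neq0 //.
  by rewrite subrr mul0r.
move=> a0 b0 /(powP _ a0)[k aE] /(powP _ b0)[l bE].
apply/powP; first by rewrite mulf_neq0 ?invr_neq0.
by exists (k - l); rewrite aE bE expfzDr // invr_expz.
Qed.

End Convergence.

End Theta.

(** * Laurent coefficients of the truncated products *)

Lemma coef_comp_scaleX (K : comNzRingType) (P : {poly K}) (c : K) i :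
  (P \Po (c *: 'X))`_i = c ^+ i * P`_i.
Proof.
rewrite comp_polyE (eq_bigr (fun j : 'I_(size P) => (c ^+ j * P`_j) *: 'X^j)).
  rewrite -(poly_def (size P) (fun j => c ^+ j * P`_j)) coef_poly.
  by case: ltnP => // Pi; rewrite nth_default // mulr0.
by move=> j _; rewrite exprZn scalerA mulrC.
Qed.

Section Product.
Variables (K : comNzRingType) (x p : K).

(** (x y)^(2m) times the truncation at m of theta (x y) theta (x / y), as a
    polynomial in y; the powers of x keep its coefficients polynomial in x. *)
Definition theta_poly m : {poly K} :=
  \prod_(0 <= j < m) ((1 - (x * p ^+ j)%:P * 'X) * (x%:P * 'X - (p ^+ j.+1)%:P)
    * ('X - (x * p ^+ j)%:P) * (x%:P - (p ^+ j.+1)%:P * 'X)).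

(** The truncation of the quasi-periodicity of theta (x y) theta (x / y) under
    y -> p y: the four linear factors are the boundary factors that the shift
    creates and destroys. *)
Lemma theta_poly_shift m :
  (x%:P * 'X - (p ^+ m)%:P) * (p%:P * 'X - (x * p ^+ m)%:P)
    * (theta_poly m \Po (p *: 'X)) =
  (p ^+ (2 * m))%:P * ((1 - (x * p ^+ m)%:P * 'X) * (x%:P - (p * p ^+ m)%:P * 'X)
    * theta_poly m).
Proof.
elim: m => [|m IHm].
  rewrite muln0 expr0 !mulr1 /theta_poly !big_nil (_ : 1 \Po (p *: 'X) = 1); last exact: rmorph1. by rewrite !polyC1; ring.
rewrite /theta_poly !big_nat_recr //= -/(theta_poly m) comp_polyM.
have cX c : c%:P * 'X \Po (p *: 'X) = c%:P * (p%:P * 'X).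
  by rewrite comp_polyM comp_polyX comp_polyC -[p *: 'X]mul_polyC.
rewrite !comp_polyM !comp_polyB !cX !comp_polyC comp_polyX -[p *: 'X]mul_polyC polyC1.
rewrite -[p *: 'X]mul_polyC in IHm.
rewrite (_ : 2 * m.+1 = 2 * m + 2)%N; last by lia.
rewrite exprD !exprS expr0 mulr1 !polyCM.
transitivity ((x%:P * 'X - (p ^+ m)%:P) * (p%:P * 'X - (x * p ^+ m)%:P) *
   (theta_poly m \Po p%:P * 'X) *
   (p%:P * p%:P * ('X - x%:P * (p ^+ m)%:P) * (x%:P * 'X - p%:P * (p ^+ m)%:P) *
    (1 - x%:P * (p%:P * (p ^+ m)%:P) * 'X) *
    (x%:P - p%:P * (p%:P * (p ^+ m)%:P) * 'X))).
  by rewrite !polyCM; ring.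
by rewrite IHm !polyCM; ring.
Qed.

(** The coefficient of y^(i+2) in [theta_poly_shift]. For e = 0 it is a two-term
    recurrence. *)
Lemma theta_poly_rec m i (e := p ^+ m) (G := theta_poly m) :
  x * p * (p ^+ i * G`_i) - e * (x ^+ 2 + p) * (p ^+ i.+1 * G`_i.+1)
    + x * e ^+ 2 * (p ^+ i.+2 * G`_i.+2) =
  p ^+ (2 * m) * (x * G`_i.+2 - e * (p + x ^+ 2) * G`_i.+1
    + x * p * e ^+ 2 * G`_i).
Proof.
have := congr1 (fun P : {poly K} => P`_i.+2) (theta_poly_shift m).
have E1 : (x%:P * 'X - e%:P) * (p%:P * 'X - (x * e)%:P) * (G \Po (p *: 'X)) =
   (x * p)%:P * (G \Po (p *: 'X)) * 'X * 'X
   - (e * (x ^+ 2 + p))%:P * (G \Po (p *: 'X)) * 'X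
   + (x * e ^+ 2)%:P * (G \Po (p *: 'X)).
  by rewrite !polyCM !polyCD !polyCM; ring.
have E2 : (1 - (x * e)%:P * 'X) * (x%:P - (p * e)%:P * 'X) * G =
   x%:P * G - (e * (p + x ^+ 2))%:P * G * 'X + (x * p * e ^+ 2)%:P * G * 'X * 'X.
  by rewrite !polyCM !polyCD !polyCM; ring.
rewrite -/e -/G E1 E2 coefCM !coefD !coefN !coefMX /= !coefCM !coef_comp_scaleX.
by move=> ->.
Qed.

Lemma size_theta_poly m : (size (theta_poly m) <= (4 * m).+1)%N.
Proof.
elim: m => [|m IHm]; first by rewrite /theta_poly big_nil size_poly1.
rewrite /theta_poly big_nat_recr //= -/(theta_poly m).
have sM (P Q : {poly K}) k :
    (size P <= k.+1)%N -> (size Q <= 2)%N -> (size (P * Q)%R <= k.+2)%N.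
  move=> sP sQ; apply: leq_trans (size_polyMleq _ _) _.
  by move: sP sQ; case: (size P) (size Q) => [|a] [|b] //=; lia.
have s1 (c : {poly K}) (P : {poly K}) :
    (size c <= 1)%N -> (size P <= 2)%N -> (size (c - P)%R <= 2)%N.
  move=> sc sP; apply: leq_trans (size_polyD _ _) _.
  by rewrite size_polyN geq_max (leq_trans sc).
have s2 (c : K) : (size (c%:P * 'X)%R <= 2)%N.
  by rewrite mul_polyC (leq_trans (size_scale_leq _ _)) // size_polyX.
have s3 (P : {poly K}) (c : K) : (size P <= 2)%N -> (size (P - c%:P)%R <= 2)%N.
  move=> sP; apply: leq_trans (size_polyD _ _) _.
  by rewrite size_polyN geq_max sP (leq_trans (size_polyC_leq1 _)).
rewrite !mulrA (_ : 4 * m.+1 = (4 * m).+4)%N; last by lia.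
apply: (sM); last by apply: s1; rewrite ?size_polyC_leq1.
apply: (sM); last by apply: s3; rewrite size_polyX.
apply: (sM); last exact: s3.
by apply: (sM) => //; apply: s1; rewrite ?size_poly1.
Qed.

End Product.

Section Majorant.
Variable R : realType.
Local Notation C := R[i].
Local Notation N := (@Normc.normc R).

Definition majorised (P : {poly C}) (Q : {poly R}) := forall i, N P`_i <= Q`_i.

Lemma majorisedC c : majorised c%:P (N c)%:P.
Proof. by move=> i; rewrite !coefC; case: eqP; rewrite ?Normc.normc0. Qed.

Lemma majorisedD P P' Q Q' :
  majorised P Q -> majorised P' Q' -> majorised (P + P') (Q + Q').
Proof.
by move=> PQ PQ' i; rewrite !coefD (le_trans (ler_normc_add _ _)) // lerD.
Qed.

Lemma majorisedN P Q : majorised P Q -> majorised (- P) Q.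
Proof. by move=> PQ i; rewrite coefN normc_opp. Qed.

Lemma majorisedM P P' Q Q' :
  majorised P Q -> majorised P' Q' -> majorised (P * P') (Q * Q').
Proof.
move=> PQ PQ' i; rewrite !coefM (le_trans (ler_normc_sum _ _ _)) // ler_sum // => j _.
by rewrite Normc.normcM ler_pM ?normc_nonneg.
Qed.

Lemma majorisedX : majorised 'X 'X.
Proof.
by move=> i; rewrite !coefX; case: eqP; rewrite ?Normc.normc1 ?Normc.normc0.
Qed.

Variables (x p : C) (p1 : `|p| < 1) (x0 : x != 0).

(** The polynomial [theta_poly] with every coefficient of its linear factors
    replaced by its norm. *)
Definition theta_majorant m : {poly R} :=
  \prod_(0 <= j < m) ((1 + (N (x * p ^+ j))%:P * 'X) * ((N x)%:P * 'X + (N (p ^+ j.+1))%:P)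
    * ('X + (N (x * p ^+ j))%:P) * ((N x)%:P + (N (p ^+ j.+1))%:P * 'X)).

Lemma theta_poly_majorised m : majorised (theta_poly x p m) (theta_majorant m).
Proof.
have one : majorised 1 1 by rewrite -!polyC1 -(@Normc.normc1 R); apply: majorisedC.
elim: m => [|m IHm]; first by rewrite /theta_poly /theta_majorant !big_nil.
rewrite /theta_poly /theta_majorant !big_nat_recr //=.
do ?apply: majorisedM => //; apply: majorisedD => //; do ?apply: majorisedN;
  do ?apply: majorisedM => //; by [apply: majorisedX | apply: majorisedC].
Qed.

Lemma theta_majorant_horner (Y : R) m : 0 < Y ->
  (theta_majorant m).[Y] <= theta_bound p (theta_size (N x * Y)) *
     theta_bound p (theta_size (N x / Y)) * (N x * Y) ^+ (2 * m).
Proof.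
move=> Y0; have X0 := normc_pos x0.
have rho0 : 0 <= N p by exact: normc_nonneg.
have rho1 : N p < 1 by rewrite -ltcR -normCE.
have fac (t : R) j : 0 < t ->
    0 <= (1 + t * N p ^+ j) * (1 + N p ^+ j.+1 / t) <= 1 + theta_size t * N p ^+ j.
  move=> t0; have t1 : 0 < t^-1 by rewrite invr_gt0.
  have r1 : 0 <= N p ^+ j <= 1 by rewrite exprn_ge0 // exprn_ile1 // ltW.
  rewrite exprS /theta_size; have tt : t * t^-1 = 1 by rewrite divff // gt_eqF.
  move: (N p) (N p ^+ j) (t^-1) rho0 rho1 r1 t1 tt => r r' ti r0 r1 /andP[r'0 r'1] ti0 tt.
  apply/andP; split.
    by rewrite mulr_ge0 // addr_ge0 // ?mulr_ge0 // ltW.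
  have -> : (1 + t * r') * (1 + r * r' * ti) = 1 + t * r' + r * r' * ti + r * r' * r'.
    by transitivity (1 + t * r' + r * r' * ti + (t * ti) * (r * r' * r'));
      [ring | rewrite tt; ring].
  have a1 : r * r' * ti <= r' * ti by rewrite ler_wpM2r ?(ltW ti0) // ler_piMl // ltW.
  have a2 : r * r' * r' <= r' by rewrite ler_piMl // mulr_ile1 // ltW.
  by lra.
have pos (s : R) j : 0 <= s -> 0 <= 1 + s * N p ^+ j.
  by move=> s0; rewrite addr_ge0 // mulr_ge0 // exprn_ge0.
have s1 : 0 <= theta_size (N x * Y) by rewrite theta_size_ge0 // mulr_ge0 // ltW.
have s2 : 0 <= theta_size (N x / Y) by rewrite theta_size_ge0 // divr_ge0 // ltW.
apply: (le_trans (y := \prod_(0 <= j < m) (1 + theta_size (N x * Y) * N p ^+ j) *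
    \prod_(0 <= j < m) (1 + theta_size (N x / Y) * N p ^+ j) * (N x * Y) ^+ (2 * m))).
  rewrite [leRHS](_ : _ = \prod_(0 <= j < m) ((1 + theta_size (N x * Y) * N p ^+ j) *
      (1 + theta_size (N x / Y) * N p ^+ j) * (N x * Y) ^+ 2)); last first.
    by rewrite 2!big_split /= prodr_const_nat subn0 exprM.
  rewrite horner_prod.
  apply: ler_prod => j _ /=.
  have := fac (N x * Y) j (mulr_gt0 X0 Y0); have := fac (N x / Y) j (divr_gt0 X0 Y0).
  move=> /andP[a1 b1] /andP[a2 b2].
  rewrite [X in 0 <= X <= _](_ : _ = (1 + N x * Y * N p ^+ j) * (1 + N p ^+ j.+1 / (N x * Y)) *
    ((1 + N x / Y * N p ^+ j) * (1 + N p ^+ j.+1 / (N x / Y))) * (N x * Y) ^+ 2).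
    apply/andP; split; first by rewrite (mulr_ge0 (mulr_ge0 a2 a1)) // exprn_ge0 // mulr_ge0 // ltW.
    by rewrite ler_wpM2r ?exprn_ge0 ?(mulr_ge0 (ltW X0) (ltW Y0)) // ler_pM.
  transitivity ((1 + N x * N p ^+ j * Y) * (N x * Y + N p ^+ j.+1) *
      (Y + N x * N p ^+ j) * (N x + N p ^+ j.+1 * Y)).
    by rewrite !hornerE !Normc.normcM !normc_exp.
  by field; rewrite !gt_eqF.
rewrite ler_wpM2r ?exprn_ge0 ?(mulr_ge0 (ltW X0) (ltW Y0)) //.
by rewrite ler_pM ?prodr_ge0 ?prod_theta_bound //; move=> *; apply: pos.
Qed.

(** A polynomial with nonnegative coefficients dominates each of its monomials at
    Y > 0, which gives Cauchy estimates without integrals. The choice of Y is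
    free: Y = 1 gives boundedness, larger and smaller Y decay on both sides. *)
Lemma theta_poly_coef_le (Y : R) : 0 < Y -> exists K, forall m i,
  N (theta_poly x p m)`_i * Y ^+ i <= K * (N x * Y) ^+ (2 * m).
Proof.
move=> Y0; eexists => m i; apply: le_trans (theta_majorant_horner m Y0).
have Q0 j : 0 <= (theta_majorant m)`_j.
  by apply: le_trans (theta_poly_majorised m j); apply: normc_nonneg.
have := theta_poly_majorised m i.
rewrite horner_coef; have [iS|iS] := ltnP i (size (theta_majorant m)).
  move=> Pi; rewrite (bigD1 (Ordinal iS)) //=.
  apply: (le_trans (y := (theta_majorant m)`_i * Y ^+ i)).
    by rewrite ler_wpM2r // exprn_ge0 // ltW.
  by rewrite lerDl sumr_ge0 // => j _; rewrite mulr_ge0 // exprn_ge0 // ltW.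
rewrite [X in _ <= X]nth_default // => Pi.
apply: (le_trans (y := 0)).
  by rewrite mulr_le0_ge0 // exprn_ge0 // ltW.
by rewrite sumr_ge0 // => j _; rewrite mulr_ge0 // exprn_ge0 // ltW.
Qed.

Lemma theta_poly_horner (y : C) m : y != 0 ->
  (theta_poly x p m).[y] =
  (x * y) ^+ (2 * m) * (theta_part (x * y) p m * theta_part (x / y) p m).
Proof.
move=> y0; rewrite /theta_poly horner_prod /theta_part -big_split /=.
rewrite exprM -[m in _ ^+ m]subn0 -prodr_const_nat -big_split.
apply: eq_bigr => j _ /=.
transitivity ((1 - x * p ^+ j * y) * (x * y - p ^+ j.+1) * (y - x * p ^+ j)
   * (x - p ^+ j.+1 * y)); first by rewrite !hornerE.
by field; rewrite x0 y0.
Qed.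

End Majorant.

(** * The theta kernel has rank two *)

Lemma cvg0_sum (K : numFieldType) (I : Type) (r : seq I) (f : I -> nat -> K) :
  (forall i, f i n @[n --> \oo] --> (0 : K)) ->
  \sum_(i <- r) f i n @[n --> \oo] --> (0 : K).
Proof.
move=> f0; elim: r => [|i r IHr].
  by under eq_fun do rewrite big_nil; apply: cvg_cst.
under eq_fun do rewrite big_cons.
have H := cvgD (f0 i) IHr; rewrite addr0 in H; exact: H.
Qed.

Lemma cvg0_cst (K : numFieldType) : (fun=> 0) n @[n --> \oo] --> (0 : K).
Proof. exact: cvg_cst. Qed.

Lemma cvg0D (K : numFieldType) (u v : nat -> K) :
  u n @[n --> \oo] --> (0 : K) -> v n @[n --> \oo] --> (0 : K) ->
  u n + v n @[n --> \oo] --> (0 : K).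
Proof. by move=> u0 v0; have H := cvgD u0 v0; rewrite addr0 in H; exact: H. Qed.

Lemma cvg0Ml (K : numFieldType) (c : K) (u : nat -> K) :
  u n @[n --> \oo] --> (0 : K) -> c * u n @[n --> \oo] --> (0 : K).
Proof.
move=> u0; have H : c * u n @[n --> \oo] --> c * 0 by apply: cvgMr.
by rewrite mulr0 in H; exact: H.
Qed.

Section RankTwo.
Variable R : realType.
Local Notation C := R[i].
Local Notation N := (@Normc.normc R).
Variables (p : C) (p1 : `|p| < 1) (p0 : p != 0).
Implicit Types (x y : C) (L m i j : nat).

Let nbounded (v : nat -> C) := exists K : R, forall m, N (v m) <= K.
Local Notation null v := (v n @[n --> \oo] --> (0 : (C : numFieldType))).

Let nbounded_cst c : nbounded (fun=> c).
Proof. by exists (N c). Qed.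

Let nboundedD u v : nbounded u -> nbounded v -> nbounded (fun m => u m + v m).
Proof.
move=> [K uK] [K' vK]; exists (K + K') => m.
by rewrite (le_trans (ler_normc_add _ _)) // lerD.
Qed.

Let nboundedM u v : nbounded u -> nbounded v -> nbounded (fun m => u m * v m).
Proof.
move=> [K uK] [K' vK]; exists (K * K') => m.
by rewrite Normc.normcM ler_pM ?normc_nonneg.
Qed.

Let nboundedN u : nbounded u -> nbounded (fun m => - u m).
Proof. by move=> [K uK]; exists K => m; rewrite normc_opp. Qed.

Let nbounded_pX : nbounded (fun m => p ^+ m).
Proof.
exists 1 => m; rewrite normc_exp exprn_ile1 ?normc_nonneg //.
by rewrite ltW // -ltcR -normCE.
Qed.

Let null_pX v : nbounded v -> null (fun m => p ^+ m * v m).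
Proof.
move=> [K vK]; apply/cvgCP.
apply: (@squeeze_cvgr _ _ _ _ (fun=> 0) (fun m => K * N p ^+ m)).
- near=> m; rewrite subr0 normc_nonneg Normc.normcM normc_exp mulrC /=.
  by rewrite ler_wpM2r ?exprn_ge0 ?normc_nonneg.
- exact: cvg_cst.
by apply: cvg_geometric; rewrite ger0_norm ?normc_nonneg // -ltcR -normCE.
Unshelve. all: by end_near. Qed.

(** The coefficient of y^(i - 2m) in the truncation at m of
    theta (x y) theta (x / y). *)
Definition theta_coef x m i := (theta_poly x p m)`_i / x ^+ (2 * m).

(** The coefficients of y^(j - L) for 0 <= j <= 2 L, which are the central ones.
    The truncation is taken at m + L so that the index never becomes negative. *)
Definition mid_coef L x m j := theta_coef x (m + L) (2 * m + L + j).

Lemma theta_coef_le x (t : C) : x != 0 -> t != 0 -> exists K, forall m i,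
  N (theta_coef x m i) * N t ^+ i <= K * N t ^+ (2 * m).
Proof.
move=> x0 t0; have [K HK] := theta_poly_coef_le p1 x0 (normc_pos t0).
exists K => m i; rewrite /theta_coef Normc.normcM Normc.normcV normc_exp.
rewrite mulrAC ler_pdivrMr ?exprn_gt0 ?normc_pos //.
by apply: le_trans (HK m i) _; rewrite -mulrA -exprMn [N t * _]mulrC.
Qed.

Lemma mid_coef_bounded L x j : x != 0 -> nbounded (fun m => mid_coef L x m j).
Proof.
move=> x0; have [K HK] := theta_coef_le x0 (oner_neq0 _); exists K => m.
by have := HK (m + L)%N (2 * m + L + j)%N; rewrite Normc.normc1 !expr1n !mulr1.
Qed.

(** [theta_poly_rec] divided by its leading monomials: what remains besides the
    two-term recurrence is p^m times a bounded sequence. *)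
Lemma mid_coef_rec L x j : x != 0 ->
  null (fun m => mid_coef L x m j.+2 - p ^+ j.+1 / p ^+ L * mid_coef L x m j).
Proof.
move=> x0; pose v m := p ^+ L *
  ((p + x ^+ 2) / x * mid_coef L x m j.+1 + - (p * p ^+ L * (p ^+ m * mid_coef L x m j))
   + - ((x ^+ 2 + p) * p ^+ j.+1 / (x * p ^+ L) * mid_coef L x m j.+1)
   + p ^+ L * (p ^+ j.+2 / p ^+ L) * (p ^+ m * mid_coef L x m j.+2)).
have bv : nbounded v.
  by do ?[exact: nbounded_cst|exact: mid_coef_bounded|exact: nbounded_pX
    |apply: nboundedN|apply: nboundedD|apply: nboundedM].
have -> : (fun m => mid_coef L x m j.+2 - p ^+ j.+1 / p ^+ L * mid_coef L x m j) =
    (fun m => p ^+ m * v m); last exact: null_pX.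
apply/funext => m; rewrite /v.
have := @theta_poly_rec _ x p (m + L) (2 * m + L + j); cbv zeta.
have pn k : p ^+ k != 0 by rewrite expf_neq0.
have cE i : (theta_poly x p (m + L))`_i = theta_coef x (m + L) i * x ^+ (2 * (m + L)).
  by rewrite /theta_coef divfK // expf_neq0.
rewrite !cE -!addnS -/(mid_coef L x m j) -/(mid_coef L x m j.+1) -/(mid_coef L x m j.+2).
set g0 := mid_coef L x m j; set g1 := mid_coef _ _ _ _; set g2 := mid_coef L x m j.+2.
have e1 k : p ^+ (2 * m + L + k) = p ^+ m * p ^+ m * p ^+ L * p ^+ k.
  by rewrite -!exprD; congr (_ ^+ _); lia.
have e2 : p ^+ (2 * (m + L)) = p ^+ m * p ^+ m * p ^+ L * p ^+ L.
  by rewrite -!exprD; congr (_ ^+ _); lia.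
rewrite !e1 e2 [p ^+ (m + L)]exprD.
have X0 : x ^+ (2 * (m + L)) != 0 by rewrite expf_neq0.
move: (x ^+ (2 * (m + L))) X0 (p ^+ m) (pn m) => X X0 P P0 E.
apply: (mulfI (_ : P * P * p ^+ L * p ^+ L * x * X != 0)); first by rewrite !mulf_neq0.
apply/eqP; rewrite -subr_eq0 -mulrBr; apply/eqP.
match type of E with ?A = ?B => transitivity (B - A) end.
  by rewrite !exprS; field; rewrite x0 pn.
by rewrite E subrr.
Qed.

(** The solution of the limiting recurrence: up to a null sequence, the coefficient
    j is this multiple of the coefficient 0 or 1, according to the parity of j. *)
Fixpoint mid_weight L j : C := match j with
  | 0 => 1
  | 1 => 1
  | j'.+2 => p ^+ j'.+1 / p ^+ L * mid_weight L j'
  end.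

Lemma mid_coef_approx L x j : x != 0 ->
  null (fun m => mid_coef L x m j - mid_weight L j * mid_coef L x m (odd j)).
Proof.
move=> x0; suff : null (fun m => mid_coef L x m j - mid_weight L j * mid_coef L x m (odd j)) /\
   null (fun m => mid_coef L x m j.+1 - mid_weight L j.+1 * mid_coef L x m (odd j.+1)) by case.
elim: j => [|j [IH1 IH2]].
  have z k : null (fun m => mid_coef L x m k - 1 * mid_coef L x m k).
    rewrite (_ : (fun m => _) = (fun=> 0)); first exact: cvg0_cst.
    by apply/funext => m; rewrite mul1r subrr.
  by split; apply: z.
split=> //; rewrite /= negbK.
have H := cvg0D (mid_coef_rec L j x0) (cvg0Ml (p ^+ j.+1 / p ^+ L) IH1).
rewrite (_ : (fun m => _) = (fun m =>
  (mid_coef L x m j.+2 - p ^+ j.+1 / p ^+ L * mid_coef L x m j) +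
  p ^+ j.+1 / p ^+ L * (mid_coef L x m j - mid_weight L j * mid_coef L x m (odd j)))).
  exact: H.
by apply/funext => m; ring.
Qed.

(** The two functions of y that span, for every x, the central part of the kernel
    in the limit. *)
Definition mid_even L y : C :=
  (\sum_(0 <= j < (2 * L).+1) if odd j then 0 else mid_weight L j * y ^+ j) / y ^+ L.
Definition mid_odd L y : C :=
  (\sum_(0 <= j < (2 * L).+1) if odd j then mid_weight L j * y ^+ j else 0) / y ^+ L.

Definition mid_sum L x y m : C :=
  (\sum_(0 <= j < (2 * L).+1) mid_coef L x m j * y ^+ j) / y ^+ L.

Lemma mid_sum_approx L x y : x != 0 -> null (fun m => mid_sum L x y m -
  (mid_coef L x m 0 * mid_even L y + mid_coef L x m 1 * mid_odd L y)).
Proof.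
move=> x0.
rewrite (_ : (fun m => _) = (fun m => \sum_(j <- index_iota 0 (2 * L).+1)
    (y ^+ j / y ^+ L) * (mid_coef L x m j - mid_weight L j * mid_coef L x m (odd j)))).
  by apply: cvg0_sum => j; apply: cvg0Ml; apply: mid_coef_approx.
apply/funext => m.
rewrite /mid_sum /mid_even /mid_odd !mulr_suml !mulr_sumr -big_split -sumrB /=.
by apply: eq_bigr => j _; case: odd; rewrite /=; ring.
Qed.

Lemma theta_part_mul x y m : x != 0 -> y != 0 ->
  theta_part (x * y) p m * theta_part (x / y) p m =
  \sum_(0 <= i < (4 * m).+1) theta_coef x m i * y ^+ i / y ^+ (2 * m).
Proof.
move=> x0 y0; have := theta_poly_horner p x0 m y0.
rewrite (horner_coef_wide _ (size_theta_poly x p m)) => E.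
have xy0 : (x * y) ^+ (2 * m) != 0 by rewrite expf_neq0 // mulf_neq0.
apply: (mulfI xy0); rewrite -E big_mkord mulr_sumr; apply: eq_bigr => i _.
by rewrite /theta_coef exprMn; field; rewrite !expf_neq0.
Qed.

Lemma geom_half_sum (n : nat) : \sum_(0 <= k < n) (2^-1 : R) ^+ k.+1 <= 1.
Proof.
suff -> : \sum_(0 <= k < n) (2^-1 : R) ^+ k.+1 = 1 - 2^-1 ^+ n.
  by rewrite lerBlDr lerDl exprn_ge0.
elim: n => [|n IH]; first by rewrite big_nil expr0 subrr.
by rewrite big_nat_recr //= IH exprS; field.
Qed.

(** The coefficient bound with Y = |y| / 2 controls the terms below the centre, and
    with Y = 2 |y| those above it; each tail is a geometric series. *)
Lemma mid_sum_tail x y : x != 0 -> y != 0 -> exists K : R, 0 <= K /\ forall L m,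
  N (theta_part (x * y) p (m + L) * theta_part (x / y) p (m + L) - mid_sum L x y m)
    <= K * 2^-1 ^+ L.
Proof.
move=> x0 y0.
pose t M i := theta_coef x M i * y ^+ i / y ^+ (2 * M).
have tle (s : C) : s != 0 -> exists K, forall M i, N (t M i) * N s ^+ i <= K * N s ^+ (2 * M).
  move=> s0; have [K HK] := theta_coef_le x0 (mulf_neq0 s0 y0); exists K => M i.
  have yM : 0 < N y ^+ (2 * M) by rewrite exprn_gt0 ?normc_pos.
  rewrite /t 2!Normc.normcM Normc.normcV !normc_exp mulrAC ler_pdivrMr //.
  have := HK M i; rewrite [N (s * y)]Normc.normcM !exprMn -!mulrA.
  by rewrite [N y ^+ i * _]mulrC.
have two0 : (2 : C) != 0 by rewrite pnatr_eq0.
have [K1 HK1] := tle 2^-1 (invr_neq0 two0).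
have [K2 HK2] := tle 2 two0.
have N2 : N 2 = 2 :> R.
  by apply: (@complexI R); rewrite -normCE normr_nat rmorph_nat.
have h1 M i : (i <= 2 * M)%N -> N (t M i) <= K1 * 2^-1 ^+ (2 * M - i).
  move=> iM; have := HK1 M i; rewrite Normc.normcV N2.
  rewrite -[in leRHS](subnK iM) exprD mulrA ler_pM2r ?exprn_gt0 ?invr_gt0 ?ltr0n //.
have h2 M i : (2 * M <= i)%N -> N (t M i) <= K2 * 2^-1 ^+ (i - 2 * M).
  move=> iM; have := HK2 M i; rewrite N2.
  have := subnK iM; move: (i - 2 * M)%N => k ki.
  rewrite -ki exprD mulrA ler_pM2r ?exprn_gt0 //.
  by rewrite exprVn ler_pdivlMr ?exprn_gt0.
have K10 : 0 <= K1 by have := h1 0%N 0%N isT; rewrite mulr1; apply: le_trans; apply: normc_nonneg.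
have K20 : 0 <= K2 by have := h2 0%N 0%N isT; rewrite mulr1; apply: le_trans; apply: normc_nonneg.
exists (K1 + K2); split; first exact: addr_ge0.
move=> L m; rewrite theta_part_mul //.
rewrite (_ : \sum_(0 <= i < _) _ = \sum_(0 <= i < (4 * (m + L)).+1) t (m + L)%N i) //.
rewrite (@big_cat_nat _ _ _ (2 * m + 3 * L).+1) //=; last by lia.
rewrite (@big_cat_nat _ _ _ (2 * m + L)%N) //=; last by lia.
have -> : \sum_(2 * m + L <= i < (2 * m + 3 * L).+1) t (m + L)%N i = mid_sum L x y m.
  rewrite /mid_sum -{1}[(2 * m + L)%N]add0n big_addn mulr_suml.
  rewrite (_ : _ - _ = (2 * L).+1)%N; last by lia.
  apply: eq_bigr => j _; rewrite /t /mid_coef [(j + _)%N]addnC.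
  rewrite (_ : 2 * (m + L) = 2 * m + L + L)%N; last by lia.
  by rewrite !exprD; field; rewrite !expf_neq0.
rewrite addrAC addrK.
apply: le_trans (ler_normc_add _ _) _; rewrite mulrDl lerD //.
  apply: le_trans (ler_normc_sum _ _ _) _; rewrite big_nat_rev /= add0n.
  apply: (le_trans (y := \sum_(0 <= k < 2 * m + L) K1 * 2^-1 ^+ L * 2^-1 ^+ k.+1)).
    rewrite !big_nat; apply: ler_sum => k /andP[_ km].
    apply: le_trans (h1 _ _ _) _; first by lia.
    by rewrite -mulrA -exprD (_ : _ - _ = L + k.+1)%N //; lia.
  rewrite -mulr_sumr -[leRHS]mulr1 ler_wpM2l ?geom_half_sum //.
  by rewrite mulr_ge0 // exprn_ge0 // invr_ge0.
apply: le_trans (ler_normc_sum _ _ _) _.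
rewrite -{1}[(2 * m + 3 * L).+1]add0n big_addn.
apply: (le_trans (y := \sum_(0 <= k < (4 * (m + L)).+1 - (2 * m + 3 * L).+1) K2 * 2^-1 ^+ L * 2^-1 ^+ k.+1)).
  rewrite !big_nat; apply: ler_sum => k /andP[_ km].
  apply: le_trans (h2 _ _ _) _; first by lia.
  by rewrite -mulrA -exprD (_ : _ - _ = L + k.+1)%N //; lia.
rewrite -mulr_sumr -[leRHS]mulr1 ler_wpM2l ?geom_half_sum //.
by rewrite mulr_ge0 // exprn_ge0 // invr_ge0.
Qed.

Definition theta_kernel x y := theta (x * y) p * theta (x / y) p.

(** The approximant is a sum of two products of a function of x and a function of
    y. *)
Lemma theta_kernel_approx x y : x != 0 -> y != 0 -> exists K : R, forall L,
  \forall m \near \oo, N (mid_coef L x m 0 * mid_even L y +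
     mid_coef L x m 1 * mid_odd L y - theta_kernel x y) <= K * 2^-1 ^+ L.
Proof.
move=> x0 y0; have [K [K0 HK]] := mid_sum_tail x0 y0; exists (K + 2) => L.
have hL : 0 < (2^-1 : R) ^+ L by rewrite exprn_gt0 // invr_gt0.
have /cvgCP/cvgrPdist_lt/(_ _ hL) H1 := mid_sum_approx L y x0.
have H2 : theta_part (x * y) p n * theta_part (x / y) p n @[n --> \oo] -->
    (theta_kernel x y : (C : numFieldType)).
  by apply: cvgM; apply: cvg_theta.
have {H2}/cvgCP/cvgrPdist_lt/(_ _ hL) [M _ H2] := H2.
near=> m.
have h1 : N (mid_sum L x y m - (mid_coef L x m 0 * mid_even L y +
     mid_coef L x m 1 * mid_odd L y)) < 2^-1 ^+ L.
  have : `|0 - N (mid_sum L x y m - (mid_coef L x m 0 * mid_even L y +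
     mid_coef L x m 1 * mid_odd L y) - 0)| < 2^-1 ^+ L by near: m.
  by rewrite sub0r normrN subr0 ger0_norm ?normc_nonneg.
have h2 : N (theta_part (x * y) p (m + L) * theta_part (x / y) p (m + L) - theta_kernel x y)
    < 2^-1 ^+ L.
  have : (M <= m + L)%N.
    by rewrite (@leq_trans m) ?leq_addr //; near: m; exact: nbhs_infty_ge.
  by move=> /H2 /=; rewrite sub0r normrN ger0_norm ?normc_nonneg.
have h3 := HK L m.
rewrite (_ : _ - _ = - (mid_sum L x y m - (mid_coef L x m 0 * mid_even L y +
     mid_coef L x m 1 * mid_odd L y))
   + (- (theta_part (x * y) p (m + L) * theta_part (x / y) p (m + L) - mid_sum L x y m)
   + (theta_part (x * y) p (m + L) * theta_part (x / y) p (m + L) - theta_kernel x y))); last by ring.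
apply: le_trans (ler_normc_add _ _) _; rewrite normc_opp.
have := ler_normc_add (- (theta_part (x * y) p (m + L) * theta_part (x / y) p (m + L) - mid_sum L x y m))
 (theta_part (x * y) p (m + L) * theta_part (x / y) p (m + L) - theta_kernel x y).
rewrite normc_opp; lra.
Unshelve. all: by end_near. Qed.

End RankTwo.

(** * Minors, Pfaffian and the addition formula *)

Definition det3 (K : comNzRingType) (f : 'I_3 -> 'I_3 -> K) : K :=
  f 0 0 * (f 1 1 * f 2 2 - f 1 2 * f 2 1)
  - f 0 1 * (f 1 0 * f 2 2 - f 1 2 * f 2 0)
  + f 0 2 * (f 1 0 * f 2 1 - f 1 1 * f 2 0).

Lemma det3_lim0 (K : numFieldType) (a : nat -> 'I_3 -> 'I_3 -> K) l :
  (forall i j, a n i j @[n --> \oo] --> (l i j : K)) ->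
  (forall n, det3 (a n) = 0) -> det3 l = 0.
Proof.
move=> al a0.
have minor i1 j1 i2 j2 i3 j3 i4 j4 i0 j0 :
    a n i0 j0 * (a n i1 j1 * a n i2 j2 - a n i3 j3 * a n i4 j4) @[n --> \oo] -->
    (l i0 j0 * (l i1 j1 * l i2 j2 - l i3 j3 * l i4 j4) : K).
  by apply: cvgM (al _ _) _; apply: cvgB; apply: cvgM; apply: al.
have H : det3 (a n) @[n --> \oo] --> (det3 l : K).
  by apply: cvgD (minor _ _ _ _ _ _ _ _ _ _); apply: cvgB; apply: minor.
apply: (cvgK_unique H); rewrite (_ : (fun n => _) = (fun=> 0)); first exact: cvg0_cst.
by apply/funext.
Qed.

Lemma det3_rank2 (K : comNzRingType) (a b w v : 'I_3 -> K) :
  det3 (fun i j => a i * w j + b i * v j) = 0.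
Proof. by rewrite /det3; ring. Qed.

(** For an antisymmetric four by four matrix, the minor that omits row v and
    column u is the entry (x, y) times the Pfaffian. So the Pfaffian vanishes if some
    entry f x _ is nonzero, and trivially otherwise. *)
Lemma pfaffian_of_minors (F : fieldType) (k : F -> F -> F)
  (f := fun x y => k x y / x) :
  (forall x y : 'I_3 -> F, (forall i, x i != 0) -> (forall i, y i != 0) ->
     det3 (fun i j => k (x i) (y j)) = 0) ->
  (forall x, x != 0 -> k x x = 0) ->
  (forall x y, x != 0 -> y != 0 -> f y x = - f x y) ->
  forall x y u v, x != 0 -> y != 0 -> u != 0 -> v != 0 ->
  f x y * f u v - f x u * f y v + f x v * f y u = 0.
Proof.
move=> minor k0 anti.
have fE s t : s != 0 -> k s t = s * f s t by move=> s0; rewrite /f mulrC divfK.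
have fss s : s != 0 -> f s s = 0 by move=> s0; rewrite /f k0 // mul0r.
clearbody f.
have aux x y u v : x != 0 -> y != 0 -> u != 0 -> v != 0 -> f x y != 0 ->
    f x y * f u v - f x u * f y v + f x v * f y u = 0.
  move=> x0 y0 u0 v0 fxy.
  pose X (i : 'I_3) := nth 0 [:: x; y; u] i; pose Y (i : 'I_3) := nth 0 [:: x; y; v] i.
  have X0 i : X i != 0 by case: i => [[|[|[]]]].
  have Y0 i : Y i != 0 by case: i => [[|[|[]]]].
  have := minor _ _ X0 Y0; rewrite /det3 /X /Y /= !fE // !fss //.
  rewrite (anti x y) // (anti x u) // (anti y u) // => E.
  have c0 : x * y * u * f x y != 0 by rewrite !mulf_neq0.
  by apply: (mulfI c0); rewrite mulr0 -[RHS]E; ring.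
move=> x y u v x0 y0 u0 v0.
have [fxy|] := eqVneq (f x y) 0; last exact: aux.
have [fxu|fxu] := eqVneq (f x u) 0; last first.
  have := aux x u y v x0 u0 y0 v0 fxu; rewrite (anti y u) // => E.
  by rewrite -[LHS]opprK -[RHS]oppr0; congr (- _); rewrite -[RHS]E; ring.
have [fxv|fxv] := eqVneq (f x v) 0; first by rewrite fxy fxu fxv !mul0r subrr addr0.
have := aux x v u y x0 v0 u0 y0 fxv; rewrite (anti y u) // fxy fxu => E.
by rewrite -[LHS]opprK -[RHS]oppr0; congr (- _); rewrite -[RHS]E; ring.
Qed.

(** The Pfaffian at the four points s k, k, u, v below, chosen such that their
    products and quotients are the twelve arguments of the addition formula. The
    square roots W, Z1, Z2, Y of the parameters are needed to write the points
    down. *)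
Lemma three_term_of_pfaffian (F : fieldType) (th : F -> F)
  (f := fun x y => th (x * y) * th (x / y) / x) :
  (forall a, a != 0 -> th a^-1 = - th a / a) ->
  (forall x y u v, x != 0 -> y != 0 -> u != 0 -> v != 0 ->
     f x y * f u v - f x u * f y v + f x v * f y u = 0) ->
  forall s W Z1 Z2 Y, s != 0 -> W != 0 -> Z1 != 0 -> Z2 != 0 -> Y != 0 ->
  th s * th (s * Z2 ^+ 2 * W ^+ 2 / (Y ^+ 2 * Z1 ^+ 2)) * th (Z1 ^+ 2 / Y ^+ 2)
    * th (W ^+ 2 / Z2 ^+ 2) =
  th (s * Z2 ^+ 2 / Y ^+ 2) * th (s * W ^+ 2 / Z1 ^+ 2) * th (Z1 ^+ 2 / Z2 ^+ 2)
    * th (W ^+ 2 / Y ^+ 2) +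
  Z1 ^+ 2 / Z2 ^+ 2 * (th (s * Z2 ^+ 2 / Z1 ^+ 2) * th (Z2 ^+ 2 / Y ^+ 2)
    * th (s * W ^+ 2 / Y ^+ 2) * th (W ^+ 2 / Z1 ^+ 2)).
Proof.
rewrite {}/f => thV Pf s W Z1 Z2 Y s0 W0 Z10 Z20 Y0.
have nz (a b c d : F) : a != 0 -> b != 0 -> c != 0 -> d != 0 -> a * b / (c * d) != 0.
  by move=> *; rewrite !mulf_neq0 ?invr_neq0 ?mulf_neq0.
pose k := W * Z2 / (Y * Z1); pose u := W * Z1 / (Y * Z2); pose v := Z1 * Z2 / (Y * W).
have k0 : k != 0 by exact: nz.
have u0 : u != 0 by exact: nz.
have v0 : v != 0 by exact: nz.
have sk0 : s * k != 0 by rewrite mulf_neq0.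
have := Pf _ _ _ _ sk0 k0 u0 v0.
have -> : s * k * k = s * Z2 ^+ 2 * W ^+ 2 / (Y ^+ 2 * Z1 ^+ 2).
  by rewrite /k; field; rewrite Y0 Z10.
have -> : s * k / k = s by rewrite mulfK.
have -> : u * v = Z1 ^+ 2 / Y ^+ 2 by rewrite /u /v; field; rewrite Y0 W0 Z20.
have -> : u / v = W ^+ 2 / Z2 ^+ 2 by rewrite /u /v; field; rewrite Y0 W0 Z20 Z10.
have -> : s * k * u = s * W ^+ 2 / Y ^+ 2 by rewrite /u /k; field; rewrite Y0 Z20 Z10.
have -> : s * k / u = s * Z2 ^+ 2 / Z1 ^+ 2.
  by rewrite /u /k; field; rewrite Y0 W0 Z20 Z10.
have -> : k * v = Z2 ^+ 2 / Y ^+ 2 by rewrite /k /v; field; rewrite Y0 W0 Z10.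
have -> : k / v = W ^+ 2 / Z1 ^+ 2 by rewrite /k /v; field; rewrite Y0 W0 Z20 Z10.
have -> : s * k * v = s * Z2 ^+ 2 / Y ^+ 2 by rewrite /k /v; field; rewrite Y0 W0 Z10.
have -> : s * k / v = s * W ^+ 2 / Z1 ^+ 2.
  by rewrite /k /v; field; rewrite Y0 W0 Z20 Z10.
have -> : k * u = W ^+ 2 / Y ^+ 2 by rewrite /k /u; field; rewrite Y0 Z20 Z10.
have -> : k / u = Z2 ^+ 2 / Z1 ^+ 2 by rewrite /k /u; field; rewrite Y0 W0 Z20 Z10.
have zV : th (Z2 ^+ 2 / Z1 ^+ 2) = - th (Z1 ^+ 2 / Z2 ^+ 2) / (Z1 ^+ 2 / Z2 ^+ 2).
  by rewrite -thV ?invf_div // mulf_neq0 ?invr_neq0 ?expf_neq0.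
have kE : k = u * (Z2 ^+ 2 / Z1 ^+ 2) by rewrite /k /u; field; rewrite Y0 Z20 Z10.
rewrite zV kE => E.
have c0 : (s * k * u)^-1 != 0 by rewrite invr_neq0 // mulf_neq0.
apply: (mulfI c0); apply/eqP; rewrite -subr_eq0 -mulrBr; apply/eqP; rewrite -[RHS]E kE.
by clearbody u; field; rewrite s0 u0 Z10 Z20.
Qed.

Section ThreeTerm.
Variable R : realType.
Local Notation C := R[i].
Local Notation N := (@Normc.normc R).
Variables (p : C) (p1 : `|p| < 1).

Section Minor.
Hypothesis p0 : p != 0.

(** A limit of matrices of rank at most two. For each L one index m serves all nine
    entries. *)
Lemma theta_kernel_minor (x y : 'I_3 -> C) :
  (forall i, x i != 0) -> (forall i, y i != 0) ->
  det3 (fun i j => theta_kernel p (x i) (y j)) = 0.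
Proof.
move=> x0 y0.
have /choice[K HK] : forall ij : 'I_3 * 'I_3, exists K : R, forall L,
  \forall m \near \oo, N (mid_coef p L (x ij.1) m 0 * mid_even p L (y ij.2) +
     mid_coef p L (x ij.1) m 1 * mid_odd p L (y ij.2) - theta_kernel p (x ij.1) (y ij.2))
    <= K * 2^-1 ^+ L.
  by move=> ij; apply: theta_kernel_approx.
have /choice[m Hm] : forall L, exists m, forall ij : 'I_3 * 'I_3,
  N (mid_coef p L (x ij.1) m 0 * mid_even p L (y ij.2) +
     mid_coef p L (x ij.1) m 1 * mid_odd p L (y ij.2) - theta_kernel p (x ij.1) (y ij.2))
    <= K ij * 2^-1 ^+ L.
  move=> L; have [M _ HM] := filter_forall _ (fun ij => HK ij L).
  by exists M => ij; apply: (HM M) => /=.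
pose a L i j := mid_coef p L (x i) (m L) 0 * mid_even p L (y j) +
     mid_coef p L (x i) (m L) 1 * mid_odd p L (y j).
apply: (@det3_lim0 _ a); last by move=> L; apply: det3_rank2.
move=> i j; apply/cvgCP.
apply: (@squeeze_cvgr _ _ _ _ (fun=> 0) (fun L => K (i, j) * 2^-1 ^+ L)).
- by near=> L; rewrite normc_nonneg /=; apply: (Hm L (i, j)).
- exact: cvg_cst.
by apply: cvg_geometric; rewrite ger0_norm ?invr_ge0 // invf_lt1 ?ltr1n.
Unshelve. all: by end_near. Qed.

Lemma theta_pfaffian (x y u v : C)
    (f := fun s t => theta (s * t) p * theta (s / t) p / s) :
  x != 0 -> y != 0 -> u != 0 -> v != 0 ->
  f x y * f u v - f x u * f y v + f x v * f y u = 0.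
Proof.
apply: (@pfaffian_of_minors _ (theta_kernel p)) => {x y u v f}.
- exact: theta_kernel_minor.
- by move=> x x0; rewrite /theta_kernel divff // theta1 // mulr0.
move=> x y x0 y0; rewrite /theta_kernel [y * x]mulrC -[y / x]invf_div thetaV //.
  by field; rewrite x0 y0.
by rewrite mulf_neq0 ?invr_neq0.
Qed.

End Minor.

Lemma theta_three_term (s w z1 z2 y : C) :
    s != 0 -> w != 0 -> z1 != 0 -> z2 != 0 -> y != 0 ->
  theta s p * theta (s * z2 * w / (y * z1)) p * theta (z1 / y) p * theta (w / z2) p =
  theta (s * z2 / y) p * theta (s * w / z1) p * theta (z1 / z2) p * theta (w / y) p +
  z1 / z2 * (theta (s * z2 / z1) p * theta (z2 / y) p * theta (s * w / y) p * theta (w / z1) p).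
Proof.
move=> s0 w0 z10 z20 y0; have [p0|p0] := eqVneq p 0.
  have th0 a : a != 0 -> theta a p = 1 - a.
    move=> a0; apply: (@cvgC_unique _ (theta_part a p)); first exact: cvg_theta.
    apply/cvgCP; apply: cvg_near_cst; exists 1%N => // -[//|n] _ /=.
    rewrite /theta_part big_nat_recl // big1 => [|j _].
      by rewrite p0 expr0 expr1 mul0r subr0 !mulr1 subrr Normc.normc0.
    by rewrite p0 !expr0n /= mulr0 mul0r !subr0 mulr1.
  rewrite !th0 ?mulf_neq0 ?invr_neq0 ?mulf_neq0 //.
  by field; rewrite y0 z10 z20.
have [W W0 wE] : exists2 S : C, S != 0 & w = S ^+ 2.
  by exists (sqrtC w); rewrite ?sqrtC_eq0 ?sqrtCK.
have [Z1 Z10 z1E] : exists2 S : C, S != 0 & z1 = S ^+ 2.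
  by exists (sqrtC z1); rewrite ?sqrtC_eq0 ?sqrtCK.
have [Z2 Z20 z2E] : exists2 S : C, S != 0 & z2 = S ^+ 2.
  by exists (sqrtC z2); rewrite ?sqrtC_eq0 ?sqrtCK.
have [Y Y0 yE] : exists2 S : C, S != 0 & y = S ^+ 2.
  by exists (sqrtC y); rewrite ?sqrtC_eq0 ?sqrtCK.
move: w0 z10 z20 y0; rewrite {}wE {}z1E {}z2E {}yE => _ _ _ _.
apply: (@three_term_of_pfaffian _ (fun a => theta a p)) => //; first exact: thetaV.
by move=> *; apply: theta_pfaffian.
Qed.

Lemma theta_is_theta_like : theta_like (fun a => theta a p).
Proof.
split; [exact: theta1 | exact: thetaV | exact: theta_zero_div | exact: theta_three_term].
Qed.

End ThreeTerm.

Local Close Scope classical_set_scope.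

(** * The summation formula *)

Theorem theorem11p2 (R : realType) (q p : R[i]) (n N : nat)
  (a c d e : R[i]) (b x : 'I_n -> R[i]) :
  let B : R[i] := \prod_(r < n) b r in
  (1 <= n)%N ->
  q != 0 -> `|p| < 1 ->
  a != 0 -> c != 0 -> d != 0 -> e != 0 ->
  (forall r, b r != 0) -> (forall r, x r != 0) ->
  (* no denominator vanishes; in the sum, k_r and |k| both range over 0..N *)
  (forall r s : 'I_n, (r < s)%N -> theta (x r / x s) p != 0) ->
  (forall (r s : 'I_n) (m : nat), (m <= N)%N ->
     qpfact (q * x r / x s) q p m != 0) ->
  theta a p != 0 ->
  (forall m : nat, (m <= N)%N ->
     qpfacts [:: a * q / B; a * q / c; a * q / d;
                 B * c * d * q ^- N / a; a * q ^+ N.+1] q p m != 0) ->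
  (forall (r : 'I_n) (m : nat), (m <= N)%N -> qpfact (e * x r) q p m != 0) ->
  (forall (r : 'I_n) (m : nat), (m <= N)%N ->
     qpfact (e * x r / b r) q p m != 0) ->
  qpfacts [:: a * q / B; a * q / c; a * q / d; a * q / (B * c * d)] q p N
    != 0 ->
  \sum_(k : {ffun 'I_n -> 'I_N.+1} | (\sum_(r < n) k r <= N)%N)
    (let K : nat := (\sum_(r < n) k r)%N in
     (\prod_(r < n) \prod_(s < n | (r < s)%N)
        (theta (q ^ ((k r : nat)%:Z - (k s : nat)%:Z) * x r / x s) p
         / theta (x r / x s) p))
     * (\prod_(r < n) \prod_(s < n)
          (qpfact (b s * x r / x s) q p (k r)
           / qpfact (q * x r / x s) q p (k r)))
     * (theta (a * q ^+ (2 * K)) p / theta a p)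
     * (qpfacts [:: a; c; d; a ^+ 2 * q ^+ N.+1 / (B * c * d); q ^- N] q p K
        / qpfacts [:: a * q / B; a * q / c; a * q / d;
                      B * c * d * q ^- N / a; a * q ^+ N.+1] q p K)
     * (\prod_(r < n)
          ((qpfact (e * x r / B) q p (k r) * qpfact (e * x r) q p K)
           / (qpfact (e * x r) q p (k r) * qpfact (e * x r / b r) q p K)))
     * q ^+ (\sum_(r < n) r.+1 * k r)%N)
  = qpfacts [:: a * q; a * q / (B * c); a * q / (B * d); a * q / (c * d)] q p N
    / qpfacts [:: a * q / B; a * q / c; a * q / d; a * q / (B * c * d)] q p N.
Proof.
move=> B n1 q0 p1 a0 c0 d0 e0 b0 x0 hx hq ha hden he heb _.
exact: (@multi_jackson _ (fun z => theta z p) q n N a c d e b x n1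
  (theta_is_theta_like p1) q0 a0 c0 d0 e0 b0 x0 hx hq ha hden he heb).
Qed.
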